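(* Let $0\neq x\in L^1(\widetilde{\mathcal{M}},\tau)+\mathcal{M}$ and $a\in\widetilde{\mathcal{M}}$. Let $\nu$ be the measure on $[0,\infty)$ given by $d\nu=\mu_t(x)\,dt$, and regard the function $\mu(a):t\mapsto\mu_t(a)$ as an element of $L^0([0,\infty),\nu)$. Then the decreasing rearrangement of $\mu(a)$ with respect to $\nu$ is $\mu(a,x)$.
   Context: $\mathcal{M}$ is a semi-finite von Neumann algebra equipped with a semi-finite normal faithful trace $\tau$; $\mathcal{M}_P$ is its lattice of projections and $\widetilde{\mathcal{M}}$ the set of $\tau$-measurable operators. For $a\in\widetilde{\mathcal{M}}$ and $t>0$, $\mu_t(a)=\inf\{\|ap\|: p\in\mathcal{M}_P,\ \tau(1-p)\le t\}$. $L^1(\widetilde{\mathcal{M}},\tau)$ is the set of $a\in\widetilde{\mathcal{M}}$ with $\tau(|a|)=\int_0^\infty\mu_t(a)\,dt<\infty$. For the fixed $x$, $\tau_x:\widetilde{\mathcal{M}}\to[0,\infty]$ is $\tau_x(a)=\int_0^\infty\mu_t(a)\mu_t(x)\,dt$. For $a\in\widetilde{\mathcal{M}}$ the function $\mu(a,x):[0,\infty)\to[0,\infty]$ is $\mu_t(a,x)=\inf\{\|ae\|: e\in\mathcal{M}_P,\ \tau_x(1-e)\le t\}$. For a $\nu$-measurable function $f$ on $[0,\infty)$, its distribution function with respect to $\nu$ is $d_s(f,\nu)=\nu(\{r:|f(r)|>s\})$, $s\ge0$, and its decreasing rearrangement with respect to $\nu$ is the function on $[0,\infty)$ given by $\mu_t(f,\nu)=\inf\{s\ge0: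 d_s(f,\nu)\le t\}$ (with $\inf\emptyset=\infty$). *)

(* Defs.v *)
From HB Require Import structures.
From mathcomp Require Import all_boot all_order all_algebra.
From mathcomp Require Import sesquilinear complex.
From mathcomp Require Import all_classical all_reals all_analysis.
From mathcomp Require Import measurable_realfun.

Set Implicit Arguments.
Unset Strict Implicit.
Unset Printing Implicit Defensive.

Import Order.TTheory GRing.Theory Num.Theory.
Import numFieldNormedType.Exports.

Local Open Scope classical_set_scope.
Local Open Scope ring_scope.
Local Open Scope complex_scope.

(* A complex Hilbert space is a complete normed module H over R[i] with an
   inner product dot (linear in its first argument) that induces the norm. *)

Section Operators.
Context (R : realType) (H : completeNormedModType R[i])
        (dot : {dot H for Num.conj}).

Definition inner_product_induces_norm : Prop :=
  forall v, dot v v = `|v| ^+ 2.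

Definition bounded_operator : set (H -> H) :=
  [set b | linear b /\ continuous b].

(* For b in B(H), this says c = b^*. *)
Definition is_adjoint (b c : H -> H) : Prop :=
  forall u v, dot (b u) v = dot u (c v).

Definition unitary : set (H -> H) :=
  [set u | bounded_operator u /\
     exists c, [/\ is_adjoint u c, cancel u c & cancel c u]].

Definition commutant (S : set (H -> H)) : set (H -> H) :=
  [set b | bounded_operator b /\ forall s, S s -> b \o s = s \o b].

Record von_neumann_algebra (M : set (H -> H)) : Prop := {
  vna_bounded : M `<=` bounded_operator;
  vna_linear : forall (k : R[i]) b c, M b -> M c -> M (fun v => k *: b v + c v);
  vna_mul : forall b c, M b -> M c -> M (b \o c);
  vna_star : forall b c, M b -> is_adjoint b c -> M c;
  vna_bicommutant : commutant (commutant M) = M }.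

Definition op_le (b c : H -> H) : Prop := forall v, dot (b v) v <= dot (c v) v.

(* In the order of R[i], 0 <= z means that z is real and nonnegative; hence a
   b : B(H) satisfying this condition is self-adjoint. *)
Definition positive_part (M : set (H -> H)) : set (H -> H) :=
  [set b | M b /\ op_le (fun=> 0) b].

Definition projections (M : set (H -> H)) : set (H -> H) :=
  [set p | [/\ M p, p \o p = p & is_adjoint p p]].

Definition ortho_compl (p : H -> H) : H -> H := fun v => v - p v.

Definition op_directed (D : set (H -> H)) : Prop :=
  D !=set0 /\
  forall b c, D b -> D c -> exists d, [/\ D d, op_le b d & op_le c d].

Definition op_lub (P D : set (H -> H)) (s : H -> H) : Prop :=
  [/\ P s, forall d, D d -> op_le d s &
      forall s', P s' -> (forall d, D d -> op_le d s') -> op_le s s'].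

(* Only the values of tau on the positive part of M are meaningful. *)
Record fns_trace (M : set (H -> H)) (tau : (H -> H) -> \bar R) : Prop := {
  trace_ge0 : forall b, positive_part M b -> (0 <= tau b)%E;
  trace_add : forall b c, positive_part M b -> positive_part M c ->
    tau (fun v => b v + c v) = (tau b + tau c)%E;
  trace_scale : forall (k : R) b, 0 <= k -> positive_part M b ->
    tau (fun v => k%:C *: b v) = (k%:E * tau b)%E;
  trace_comm : forall b c, M b -> is_adjoint b c -> tau (c \o b) = tau (b \o c);
  trace_faithful : forall b, positive_part M b -> tau b = 0%E -> b = (fun=> 0);
  trace_normal : forall D s, D `<=` positive_part M -> op_directed D ->
    op_lub (positive_part M) D s -> tau s = ereal_sup (tau @` D);
  trace_semifinite : forall b, positive_part M b -> b <> (fun=> 0) ->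
    exists c, [/\ positive_part M c, c <> (fun=> 0), op_le c b &
                  (tau c < +oo)%E] }.

(* An unbounded operator is represented by its graph, a subset of H * H. *)

Definition opgraph (b : H -> H) : set (H * H) := [set q | q.2 = b q.1].

Definition opdom (a : set (H * H)) : set H := fst @` a.

Record unbounded_operator (a : set (H * H)) : Prop := {
  uop_zero : a 0;
  uop_linear : forall (k : R[i]) q r, a q -> a r -> a (k *: q + r);
  uop_functional : forall w, a (0, w) -> w = 0 }.

Definition affiliated (M : set (H -> H)) (a : set (H * H)) : Prop :=
  forall u, unitary u -> commutant M u ->
  forall v w, a (v, w) <-> a (u v, u w).

Definition tau_measurable (M : set (H -> H)) (tau : (H -> H) -> \bar R) :
    set (set (H * H)) :=
  [set a | [/\ unbounded_operator a, closed a, dense (opdom a),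
               affiliated M a &
               forall e : R, 0 < e -> exists p, [/\ projections M p,
                 range p `<=` opdom a & (tau (ortho_compl p) <= e%:E)%E]]].

(* The sum in the algebra of measurable operators: closure of the pointwise
   sum. *)
Definition strong_sum (a b : set (H * H)) : set (H * H) :=
  closure [set q | exists w1 w2,
                     [/\ a (q.1, w1), b (q.1, w2) & q.2 = w1 + w2]].

Definition comp_bounded (a : set (H * H)) (p : H -> H) : set (H * H) :=
  [set q | a (p q.1, q.2)].

(* The norm is +oo unless the operator is everywhere defined and bounded. *)
Definition opnorm (a : set (H * H)) : \bar R :=
  if `[< opdom a = setT >]
  then ereal_sup [set (complex.Re `|q.2|)%:E | q in a `&` [set q | `|q.1| <= 1]]
  else +oo%E.

Definition singular_value (M : set (H -> H)) (weight : (H -> H) -> \bar R)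
    (a : set (H * H)) (t : R) : \bar R :=
  ereal_inf [set opnorm (comp_bounded a p) | p in
    projections M `&` [set p | (weight (ortho_compl p) <= t%:E)%E]].

Definition mu (M : set (H -> H)) (tau : (H -> H) -> \bar R) :=
  singular_value M tau.

Definition L1 (M : set (H -> H)) (tau : (H -> H) -> \bar R) :
    set (set (H * H)) :=
  [set a | tau_measurable M tau a /\
    (\int[lebesgue_measure]_(t in `[0%R, +oo[) mu M tau a t < +oo)%E].

Definition L1_plus_M (M : set (H -> H)) (tau : (H -> H) -> \bar R) :
    set (set (H * H)) :=
  [set strong_sum y (opgraph z) | y in L1 M tau & z in M].

Definition tau_rel (M : set (H -> H)) (tau : (H -> H) -> \bar R)
    (x a : set (H * H)) : \bar R :=
  (\int[lebesgue_measure]_(t in `[0%R, +oo[) (mu M tau a t * mu M tau x t))%E.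

Definition mu_rel (M : set (H -> H)) (tau : (H -> H) -> \bar R)
    (a x : set (H * H)) :=
  singular_value M (fun b => tau_rel M tau x (opgraph b)) a.

(* The measure nu on [0, +oo[ with d nu = mu_t(x) dt, seen as a measure on R
   supported by [0, +oo[. *)
Definition mu_measure (M : set (H -> H)) (tau : (H -> H) -> \bar R)
    (x : set (H * H)) (A : set R) : \bar R :=
  (\int[lebesgue_measure]_(t in A `&` `[0%R, +oo[) mu M tau x t)%E.

Lemma opnorm_ge0 a : (0 <= opnorm a)%E.
Proof.
rewrite /opnorm; case: asboolP => [domT|_]; last exact: leey.
have [q aq q0] : opdom a 0 by rewrite domT.
apply: le_ereal_sup_tmp; exists (complex.Re `|q.2|)%:E.
  by exists q => //; split => //=; rewrite q0 normr0 ler01.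
by rewrite lee_fin; have := normr_ge0 q.2; rewrite lecE => /andP[].
Qed.

Lemma singular_value_ge0 M w a t : (0 <= singular_value M w a t)%E.
Proof. by apply: le_ereal_inf_tmp => _ [p _ <-]; exact: opnorm_ge0. Qed.

Lemma singular_value_nonincreasing M w a (s t : R) : s <= t ->
  (singular_value M w a t <= singular_value M w a s)%E.
Proof.
move=> st; apply: le_ereal_inf_tmp => _ [p [Mp wp] <-]; apply: ge_ereal_inf.
exists (opnorm (comp_bounded a p)) => //; exists p => //.
by split => //=; apply: le_trans wp _; rewrite lee_fin.
Qed.

Lemma measurable_singular_value M w a (D : set R) :
  measurable D -> measurable_fun D (singular_value M w a).
Proof.
move=> mD; apply: (measurability _ (ErealGenOInfty.measurableE R)) => //.
move=> _ [_ [y ->] <-]; apply: measurableI => //.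
apply: is_interval_measurable => r s /= + + z /andP[rz zs].
rewrite !in_itv/= !andbT => _ ys; apply: (lt_le_trans ys).
exact: singular_value_nonincreasing.
Qed.

Section mu_measure.
Context (M : set (H -> H)) (tau : (H -> H) -> \bar R) (x : set (H * H)).

Let mu_measure0 : mu_measure M tau x set0 = 0%E.
Proof. by rewrite /mu_measure set0I integral_set0. Qed.

Let mu_measure_ge0 A : (0 <= mu_measure M tau x A)%E.
Proof. by apply: integral_ge0 => t _; exact: singular_value_ge0. Qed.

Let mu_measure_semi_sigma_additive :
  semi_sigma_additive (mu_measure M tau x).
Proof.
move=> F mF tF mUF.
have mI : measurable (`[0%R, +oo[ : set R) by exact: measurable_itv.
rewrite /mu_measure setI_bigcupl ge0_integral_bigcup//=.
- apply: is_cvg_ereal_nneg_natsum_cond => n _ _; exact: mu_measure_ge0.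
- by move=> k; apply: (@measurableI _ (measurableTypeR R)); [exact: mF|].
- apply: measurable_singular_value; rewrite -setI_bigcupl.
  exact: measurableI.
- by move=> t _; exact: singular_value_ge0.
- by apply: trivIset_setIr.
Qed.

HB.instance Definition _ := isMeasure.Build _ _ _ (mu_measure M tau x)
  mu_measure0 mu_measure_ge0 mu_measure_semi_sigma_additive.

End mu_measure.

End Operators.

Section Rearrangement.
Context (R : realType) (nu : {measure set R -> \bar R}).

(* f is a function on [0, +oo[, possibly infinite-valued; its values at
   negative reals are irrelevant. *)
Definition distribution_function (f : R -> \bar R) (s : R) : \bar R :=
  nu [set r | 0 <= r /\ (s%:E < `|f r|)%E].

Definition decreasing_rearrangement (f : R -> \bar R) (t : R) : \bar R :=
  ereal_inf [set s%:E | s in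
    [set s | 0 <= s /\ (distribution_function f s <= t%:E)%E]].

End Rearrangement.

(* Main.v *)
From HB Require Import structures.
Require Import Defs.
From mathcomp Require Import all_boot all_order all_algebra.
From mathcomp Require Import sesquilinear complex.
From mathcomp Require Import all_classical all_reals all_analysis.
From mathcomp Require Import measurable_realfun.
From mathcomp Require Import ring lra.

Set Implicit Arguments.
Unset Strict Implicit.
Unset Printing Implicit Defensive.

Import Order.TTheory GRing.Theory Num.Theory.
Import numFieldNormedType.Exports.

Local Open Scope classical_set_scope.
Local Open Scope ring_scope.
Local Open Scope complex_scope.

(* Write Phi(r) for the integral of mu_t(x) over [0, r]. For a projection p,
   mu_t(p) is the indicator function of t < tau(p), so tau_x(p) = Phi(tau(p)).
   Both sides of the equality thus reduce to comparing, for s > 0, the values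
   tau(1 - e) over the projections e with |a e| <= s and the values r with
   mu_r(a) <= s.

   The optimal e is the spectral projection of |a| for [0, s]. It is obtained
   as a spectral projection of b = (1 + a^* a)^-1, where b u is the first
   component of the orthogonal projection of (u, 0) on the graph of a. Spectral
   projections of a bounded self-adjoint b at level c are projections on the
   kernel of |b - c| - (b - c), and |b - c| is an operator square root.

   On the range of 1 - e, a is bounded below by s; hence |a q| < s forces
   |(1 - e) q| < 1, and then tau(1 - e) <= tau(1 - q). For the last step, if
   |p q| < 1, then p (1 - q) p is invertible on the range of p, and
   V = (1 - q) (p (1 - q) p)^(-1/2) p satisfies V^* V = p and V V^* <= 1 - q. *)

(** * Real inner products and the Riesz representation *)

(** One interface for three forms used below: the real part of the inner product, <h u, v> for a
    positive h, and the inner product on pairs in which graphs are measured. *)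
Record real_form {R : realType} {V : lmodType R[i]} (f : V -> V -> R) : Prop :=
  RealForm {
  form_sym : forall u v, f u v = f v u;
  form_lin : forall (k : R) u v w, f (k%:C *: u + v) w = k * f u w + f v w;
  form_ge0 : forall u, 0 <= f u u }.

Section RealForm.
Context {R : realType} {V : lmodType R[i]} (f : V -> V -> R).
Hypothesis ff : real_form f.

Lemma formDl u v w : f (u + v) w = f u w + f v w.
Proof. by have := form_lin ff 1 u v w; rewrite scale1r mul1r. Qed.

Lemma form0l w : f 0 w = 0.
Proof. by apply: (addrI (f 0 w)); rewrite -formDl !addr0. Qed.

Lemma formZl (k : R) u w : f (k%:C *: u) w = k * f u w.
Proof. by rewrite -[_ *: _]addr0 (form_lin ff) form0l addr0. Qed.

Lemma formNl u w : f (- u) w = - f u w.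
Proof. by apply: (addrI (f u w)); rewrite -formDl !subrr form0l. Qed.

Lemma formBl u v w : f (u - v) w = f u w - f v w.
Proof. by rewrite formDl formNl. Qed.

Lemma formDr u v w : f w (u + v) = f w u + f w v.
Proof. by rewrite !(form_sym ff w) formDl. Qed.

Lemma form0r w : f w 0 = 0.
Proof. by rewrite (form_sym ff) form0l. Qed.

Lemma formZr (k : R) u w : f w (k%:C *: u) = k * f w u.
Proof. by rewrite !(form_sym ff w) formZl. Qed.

Lemma formNr u w : f w (- u) = - f w u.
Proof. by rewrite !(form_sym ff w) formNl. Qed.

Lemma formBr u v w : f w (u - v) = f w u - f w v.
Proof. by rewrite formDr formNr. Qed.

Definition formE := (formDl, formDr, formNl, formNr, formZl, formZr,
  form0l, form0r).

Lemma form_discriminant (A B C : R) : 0 <= A ->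
  (forall k, 0 <= A * k ^+ 2 + 2 * B * k + C) -> B ^+ 2 <= A * C.
Proof.
move=> Age0 h; have [A0|A0] := eqVneq A 0.
  have [->|B0] := eqVneq B 0; first by rewrite A0 mul0r expr0n.
  (* With A = 0 the polynomial is affine in k, and this k gives it the value -1. *)
  have := h (- (C + 1) / (2 * B)); rewrite A0 mul0r add0r.
  rewrite (_ : 2 * B * _ + C = - 1); last by field.
  lra.
have {A0}A1 : 0 < A by rewrite lt_neqAle eq_sym A0.
have := h (- B / A).
have -> : A * (- B / A) ^+ 2 + 2 * B * (- B / A) + C = (A * C - B ^+ 2) / A.
  by field; rewrite gt_eqF.
by rewrite pmulr_lge0 ?invr_gt0// subr_ge0.
Qed.

Lemma form_CS u v : f u v ^+ 2 <= f u u * f v v.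
Proof.
apply: form_discriminant (form_ge0 ff u) _ => k; have := form_ge0 ff (k%:C *: u + v).
rewrite !formE (form_sym ff v u).
by congr (0 <= _); ring.
Qed.

Definition form_cvg (u_ : nat -> V) (u : V) := forall e : R, 0 < e ->
  exists N, forall n, (N <= n)%N -> f (u_ n - u) (u_ n - u) <= e.

Definition form_cauchy (u_ : nat -> V) := forall e : R, 0 < e ->
  exists N, forall m n, (N <= m)%N -> (N <= n)%N ->
    f (u_ m - u_ n) (u_ m - u_ n) <= e.

Definition form_complete (G : set V) := forall u_ : nat -> V,
  (forall n, G (u_ n)) -> form_cauchy u_ -> exists2 u, G u & form_cvg u_ u.

Definition real_subspace (G : set V) :=
  G 0 /\ forall (k : R) u v, G u -> G v -> G (k%:C *: u + v).

(** The representing vector is the limit of a minimizing sequence for J u = f u u - 2 phi u. The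
    bound on phi makes J bounded below by -K, and the variation of J around the limit yields phi u =
    f u g. *)
Lemma riesz (G : set V) (phi : V -> R) (K : R) :
  real_subspace G -> form_complete G ->
  (forall k u v, G u -> G v -> phi (k%:C *: u + v) = k * phi u + phi v) ->
  0 <= K -> (forall u, G u -> phi u ^+ 2 <= K * f u u) ->
  exists2 g, G g & forall u, G u -> phi u = f u g.
Proof.
move=> [G0 GP] Gc phiP K0 phiK.
pose J u := f u u - 2 * phi u.
have JK u : G u -> - K <= J u.
  move=> Gu; have := phiK _ Gu; have := form_ge0 ff u; rewrite /J.
  move: (f u u) (phi u) => F p F0 pK.
  have [//|] := lerP (- K) (F - 2 * p).
  move=> hlt; have : (2 * p) ^+ 2 <= (K + F) ^+ 2.
    by have := sqr_ge0 (K - F); nra.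
  rewrite ler_sqr ?nnegrE; lra.
have Js : has_inf (J @` G).
  by split; [exists (J 0), 0|exists (- K) => _ [u Gu <-]; exact: JK].
set m := inf (J @` G).
have Jm u : G u -> m <= J u by move=> Gu; apply: ge_inf; [exact: Js.2|exists u].
have /choice[u_ u_P] : forall n, exists u, G u /\ J u < m + n.+1%:R^-1.
  move=> n; have ngt0 : 0 < n.+1%:R^-1 :> R by rewrite invr_gt0.
  have [_ [u Gu <-] Ju] := inf_adherent ngt0 Js.
  by exists u.
have n0 (e : R) : 0 < e -> exists N, forall n, (N <= n)%N -> n.+1%:R^-1 <= e.
  move=> e0; exists (Num.trunc (e^-1)) => n Nn.
  rewrite -[leRHS]invrK lef_pV2 ?posrE ?invr_gt0//.
  apply: ltW; apply: lt_le_trans (truncnS_gt _) _; by rewrite ler_nat.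
have phi0 : phi 0 = 0.
  by have := phiP 1 _ _ G0 G0; rewrite scaler0 addr0 mul1r; lra.
have phiZ k u : G u -> phi (k%:C *: u) = k * phi u.
  by move=> Gu; rewrite -[_ *: _]addr0 phiP// phi0 addr0.
have GZ k u : G u -> G (k%:C *: u).
  by move=> Gu; rewrite -[_ *: _]addr0; apply: GP.
(* Parallelogram identity: |u_i - u_j|^2 = 2 (J u_i + J u_j) - 4 J((u_i + u_j) / 2), and the last
   value is at least m. *)
have [||g Gg ug] := Gc u_; first by move=> n; case: (u_P n).
  move=> e e0; have [N NP] := n0 (e / 4) ltac:(lra).
  exists N => i j iN jN; have := NP _ iN; have := NP _ jN.
  have [Gi Ji] := u_P i; have [Gj Jj] := u_P j.
  move: Ji Jj; set d := _^-1; set d' := _^-1.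
  have Gm : G ((1/2)%:C *: u_ i + (1/2)%:C *: u_ j) by apply: GP => //; apply: GZ.
  have := Jm _ Gm; rewrite /J !formE phiP ?phiZ; try exact: GZ; try done.
  rewrite (form_sym ff (u_ j) (u_ i)); lra.
exists g => // u Gu.
apply/eqP; rewrite -subr_eq0 -sqrf_eq0; apply/eqP.
(* This is J(g + k u) >= J(g) up to e. It is derived from J(u_n + k u) >= m, so that J is never
   evaluated at the limit. *)
have hk k (e : R) : 0 < e -> 0 <= f u u * k ^+ 2 + 2 * (f u g - phi u) * k + e.
  move=> e0.
  have [N1 N1P] := n0 (e / 2) ltac:(lra).
  have F0 := form_ge0 ff u.
  have D0 : 0 < 16 * k ^+ 2 * f u u + 1.
    by have := sqr_ge0 k; nra.
  (* By Cauchy-Schwarz this accuracy makes 4 |k| |f u (u_n - g)| at most e; the 1 keeps the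
     denominator positive when k = 0. *)
  have [N2 N2P] := ug (e ^+ 2 / (16 * k ^+ 2 * f u u + 1))
    ltac:(by rewrite divr_gt0// exprn_gt0).
  pose n := maxn N1 N2.
  have := N1P n (leq_maxl _ _).
  have [Gn] := u_P n.
  have := Jm _ (GP k _ _ Gu Gn); rewrite /J !formE phiP//.
  rewrite (form_sym ff (u_ n) u).
  set X := f (u_ n - g) (u_ n - g); set d := _^-1.
  have := N2P n (leq_maxr _ _).
  have := form_CS u (u_ n - g); rewrite -/X formBr.
  move=> CS h3 h1 h2 h4.
  have {}h3 : 16 * k ^+ 2 * f u u * X <= e ^+ 2.
    rewrite ler_pdivlMr// in h3.
    by have := form_ge0 ff (u_ n - g); rewrite -/X => X0; nra.
  have : (4 * k * (f u (u_ n) - f u g)) ^+ 2 <= e ^+ 2.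
    apply: le_trans h3; have := sqr_ge0 k; nra.
  rewrite -(ler_sqrt _ (sqr_ge0 e)) !sqrtr_sqr.
  rewrite (gtr0_norm e0) ler_norml => /andP[h5 h6]; lra.
apply/eqP; rewrite eq_le sqr_ge0 andbT.
have := @form_discriminant (f u u) (f u g - phi u) 0 (form_ge0 ff u).
rewrite mulr0 -sqrrN opprB; apply => k.
by rewrite addr0; apply/ler_addgt0Pr => e e0; exact: hk.
Qed.

End RealForm.

(** * Bounded operators on a Hilbert space *)

Section Hilbert.
Context {R : realType} {H : completeNormedModType R[i]}.
Variable dot : {dot H for Num.conj}.
Hypothesis dotN : inner_product_induces_norm dot.

(** Real parts keep all estimates in R. Nothing is lost: [dot_Im] recovers the imaginary part, and
    [rip_is_adjoint] the complex adjoint relation. *)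
Definition rip (u v : H) : R := complex.Re (dot u v).
Definition nrm (v : H) : R := complex.Re `|v|.

Lemma normE v : `|v| = (nrm v)%:C.
Proof. by rewrite /nrm RRe_real//; apply: ger0_real; exact: normr_ge0. Qed.

Lemma nrm_ge0 v : 0 <= nrm v.
Proof. by rewrite -lecR -normE; exact: normr_ge0. Qed.

Lemma nrmE v : rip v v = nrm v ^+ 2.
Proof. by rewrite /rip dotN normE -rmorphXn. Qed.

Lemma dotC u v : dot u v = (dot v u)^*.
Proof. by rewrite (hermC dot u v) expr0 mul1r. Qed.

Lemma rip_form : real_form rip.
Proof.
split.
- by move=> u v; rewrite /rip dotC; case: (dot v u).
- move=> k u v w; rewrite /rip linearPl /=.
  by case: (dot u w) (dot v w) => a b [c d] /=; rewrite mul0r subr0.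
- by move=> u; rewrite nrmE sqr_ge0.
Qed.

Definition ripE := formE rip_form.

Lemma ripC u v : rip u v = rip v u. Proof. exact: form_sym rip_form u v. Qed.

Lemma ripZl (k : R[i]) u v : rip (k *: u) v = rip u (k^* *: v).
Proof.
by rewrite /rip linearZl_LR linearZr_LR /= conjCK.
Qed.

Lemma ripZr (k : R[i]) u v : rip u (k *: v) = rip (k^* *: u) v.
Proof. by rewrite ripZl (conjCK k). Qed.

Lemma dot_Im u v : complex.Im (dot u v) = rip u ('i *: v).
Proof.
rewrite /rip linearZr_LR /=.
by case: (dot u v) => a b /=; rewrite mul0r mulN1r opprK add0r.
Qed.

Lemma ripI u v : (forall w, rip w u = rip w v) -> u = v.
Proof.
move=> uv; apply/eqP; rewrite -subr_eq0 -normr_eq0 normE.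
by rewrite eq_complex eqxx andbT -sqrf_eq0 -nrmE (formBr rip_form) uv subrr.
Qed.

Lemma nrm0_eq0 v : nrm v = 0 -> v = 0.
Proof. by move=> v0; apply/eqP; rewrite -normr_eq0 normE v0. Qed.

Lemma nrmD u v : nrm (u + v) <= nrm u + nrm v.
Proof. by rewrite -lecR -normE rmorphD /= -!normE ler_normD. Qed.

Lemma nrmN u : nrm (- u) = nrm u.
Proof. by rewrite /nrm normrN. Qed.

Lemma nrmZ (k : R) u : nrm (k%:C *: u) = `|k| * nrm u.
Proof.
apply: complexI; rewrite -normE normrZ rmorphM /= -normE; congr (_ * _).
by rewrite normc_def /= expr0n addr0 sqrtr_sqr.
Qed.

Lemma rip_le_nrm u v : `|rip u v| <= nrm u * nrm v.
Proof.
rewrite -ler_sqr ?nnegrE ?mulr_ge0 ?nrm_ge0//.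
by rewrite real_normK ?num_real// exprMn -!nrmE; exact: form_CS rip_form u v.
Qed.

Lemma rip_cvg (u_ : nat -> H) u :
  form_cvg rip u_ u <-> u_ @ \oo --> u.
Proof.
split=> [uu|/cvgrPdist_le uu e e0].
  apply/cvgrPdist_le => e e0.
  have eE : e = (complex.Re e)%:C by rewrite RRe_real//; exact: gtr0_real.
  have {}e0 : 0 < complex.Re e by rewrite -ltcR -eE.
  have [N NP] := uu (complex.Re e ^+ 2) (exprn_gt0 _ e0).
  near=> n; rewrite distrC normE eE lecR -ler_sqr ?nnegrE ?nrm_ge0 ?(ltW e0)//.
  by rewrite -nrmE; apply: NP; near: n; exact: nbhs_infty_ge.
have e1 : 0 < (Num.sqrt e)%:C :> R[i] by rewrite ltcR sqrtr_gt0.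
have [N _ NP] := uu _ e1.
exists N => n /NP /=; rewrite distrC normE lecR => h.
rewrite nrmE -[leRHS](@sqr_sqrtr _ e) ?(ltW e0)//.
by rewrite ler_sqr ?nnegrE ?nrm_ge0 ?sqrtr_ge0.
Unshelve. all: by end_near. Qed.

Lemma closed_form_complete (G : set H) : closed G -> form_complete rip G.
Proof.
move=> cG u_ Gu uc.
have : cvg (u_ @ \oo).
  apply/cauchy_cvgP/cauchyP => e e0.
  have eE : e = (complex.Re e)%:C by rewrite RRe_real//; exact: gtr0_real.
  have {}e0 : 0 < complex.Re e by rewrite -ltcR -eE.
  have e2 : 0 < (complex.Re e / 2) ^+ 2 by rewrite exprn_gt0// divr_gt0.
  have [N NP] := uc _ e2.
  exists (u_ N); change (\forall n \near \oo, ball (u_ N) e (u_ n)).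
  near=> n; rewrite -ball_normE /= normE eE ltcR.
  have h : nrm (u_ N - u_ n) <= complex.Re e / 2.
    rewrite -ler_sqr ?nnegrE ?nrm_ge0 ?divr_ge0 ?(ltW e0)//.
    by rewrite -nrmE; apply: NP => //; near: n; exact: nbhs_infty_ge.
  by apply: le_lt_trans h _; lra.
move=> uu; exists (lim (u_ @ \oo)); last exact/rip_cvg.
by apply: closed_cvg cG _ _ uu; near=> n; exact: Gu.
Unshelve. all: by end_near. Qed.

(** Boundedness is stated with squared norms so that it combines directly with Cauchy-Schwarz;
    [bounded_operatorP] identifies it with continuity. *)
Definition blin (b : H -> H) : Prop :=
  linear b /\
  exists2 K : R, 0 <= K & forall v, rip (b v) (b v) <= K * rip v v.

Section LinearMap.
Context (b : H -> H) (lb : linear b).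

Lemma linD u v : b (u + v) = b u + b v.
Proof. by have := lb 1 u v; rewrite !scale1r. Qed.

Lemma lin0 : b 0 = 0.
Proof. by apply: (addrI (b 0)); rewrite -linD !addr0. Qed.

Lemma linZ k u : b (k *: u) = k *: b u.
Proof. by rewrite -[k *: u]addr0 lb lin0 addr0. Qed.

Lemma linN u : b (- u) = - b u.
Proof. by rewrite -scaleN1r linZ scaleN1r. Qed.

Lemma linB u v : b (u - v) = b u - b v.
Proof. by rewrite linD linN. Qed.

End LinearMap.

Lemma bounded_operatorP b : bounded_operator b <-> blin b.
Proof.
split=> -[lb hb]; (split=> //);
  pose B : {linear H -> H} := HB.pack b (GRing.isLinear.Build _ _ _ _ b lb);
  change (b : H -> H) with (B : H -> H) in hb |- *.
  have /linear_boundedP[M [Mr MP]] : bounded_near B (nbhs 0).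
    exact/linear_bounded_continuous.
  have M1 : M < `|M| + 1.
    by rewrite (le_lt_trans (real_ler_norm Mr))// ltrDl.
  have := MP _ M1; rewrite normc_def.
  set r := Num.sqrt _ => rP.
  have r0 : 0 <= r + 1 by rewrite addr_ge0// sqrtr_ge0.
  exists ((r + 1) ^+ 2) => [|v]; first exact: sqr_ge0.
  rewrite !nrmE -exprMn ler_sqr ?nnegrE ?mulr_ge0 ?nrm_ge0//.
  by rewrite -lecR rmorphM rmorphD rmorph1 /= -!normE rP.
apply/linear_bounded_continuous/linear_boundedP.
have [K K0 KP] := hb.
exists (Num.sqrt K)%:C; split; first by rewrite complex_real.
move=> r; rewrite ltcE => /andP[/= /eqP r0 rK] v.
rewrite !normE (_ : r = (complex.Re r)%:C); last by case: r r0 {rK} => /= ? ? ->.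
rewrite -rmorphM lecR.
have rp : 0 <= complex.Re r by rewrite (le_trans (sqrtr_ge0 K))// ltW.
rewrite -ler_sqr ?nnegrE ?mulr_ge0 ?nrm_ge0// exprMn -!nrmE.
apply: le_trans (KP v) _; rewrite ler_wpM2r ?(form_ge0 rip_form)//.
by rewrite -[leLHS]sqr_sqrtr// ler_sqr ?nnegrE ?sqrtr_ge0// ltW.
Qed.

Definition sadj (b : H -> H) := forall u v, rip (b u) v = rip u (b v).
Definition com (b c : H -> H) := forall v, b (c v) = c (b v).

Lemma rip_ge0 v : 0 <= rip v v. Proof. exact: form_ge0 rip_form v. Qed.
Lemma rip_CS u v : rip u v ^+ 2 <= rip u u * rip v v.
Proof. exact: form_CS rip_form u v. Qed.

Lemma blin_comp b c : blin b -> blin c -> blin (b \o c).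
Proof.
move=> [lb [K K0 KP]] [lc [L L0 LP]]; split.
  by move=> k u v; rewrite /= lc lb.
exists (K * L) => [|v /=]; first exact: mulr_ge0.
by apply: le_trans (KP _) _; rewrite -mulrA ler_wpM2l.
Qed.

Lemma blin_add b c : blin b -> blin c -> blin (fun v => b v + c v).
Proof.
move=> [lb [K K0 KP]] [lc [L L0 LP]]; split.
  by move=> k u v; rewrite /= lc lb scalerDr addrACA.
exists (2 * (K + L)) => [|v]; first by rewrite mulr_ge0// addr_ge0.
have := rip_ge0 (b v - c v); have := KP v; have := LP v.
by rewrite !ripE (ripC (c v) (b v)); lra.
Qed.

Lemma blin_scale k b : blin b -> blin (fun v => k *: b v).
Proof.
move=> [lb [K K0 KP]]; split.
  by move=> l u v; rewrite /= lb scalerDr !scalerA mulrC.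
exists (complex.Re `|k| ^+ 2 * K) => [|v]; first by rewrite mulr_ge0// sqr_ge0.
have -> : rip (k *: b v) (k *: b v) = complex.Re `|k| ^+ 2 * rip (b v) (b v).
  rewrite !nrmE /nrm normrZ -exprMn; congr (_ ^+ 2).
  by rewrite [in LHS]normE normc_def /= mul0r subr0.
by rewrite -[leRHS]mulrA; apply: ler_wpM2l; rewrite ?sqr_ge0.
Qed.

Lemma blin_id : blin id.
Proof. by split=> //; exists 1 => // v; rewrite mul1r. Qed.

Lemma blin_sub b c : blin b -> blin c -> blin (fun v => b v - c v).
Proof.
move=> bb /(blin_scale (-1)) /(blin_add bb); congr blin.
by apply/funext => v; rewrite scaleN1r.
Qed.

(** Cauchy-Schwarz often bounds X^2 by Y X; this cancels X without a case distinction on X = 0. *)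
Lemma sqr_le_cancel (X Y : R) : 0 <= Y -> X ^+ 2 <= Y * X -> X <= Y.
Proof. by move=> Y0 XY; rewrite leNgt; apply/negP => YX; nra. Qed.

Lemma adj_linear b c : linear b -> (forall u v, rip (b u) v = rip u (c v)) ->
  linear c.
Proof.
move=> lb bc k u v; apply: ripI => w.
by rewrite -bc !ripE !ripZr -!bc (linZ lb).
Qed.

(** The value of the adjoint at v represents the functional u |-> <b u, v> on the whole space. *)
Lemma adjoint_ex b : blin b ->
  exists c, blin c /\ forall u v, rip (b u) v = rip u (c v).
Proof.
move=> [lb [K K0 KP]].
have /choice[c cP] : forall v, exists w, forall u, rip (b u) v = rip u w.
  move=> v; have cT := closed_form_complete closedT.
  have [//||||w _ wP] := @riesz _ _ _ rip_form setT (fun u => rip (b u) v)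
    (K * rip v v) _ cT.
  - by move=> k u w _ _; rewrite lb !ripE.
  - by rewrite mulr_ge0// rip_ge0.
  - move=> u _; apply: le_trans (rip_CS _ _) _.
    by rewrite mulrAC ler_wpM2r ?rip_ge0.
  - by exists w => u; apply: wP.
have cP' u v : rip (b u) v = rip u (c v) by [].
exists c; split=> //; split; first exact: adj_linear cP'.
exists K => // v; apply: sqr_le_cancel; first by rewrite mulr_ge0// rip_ge0.
rewrite -{1}cP; apply: le_trans (rip_CS _ _) _.
by rewrite mulrAC ler_wpM2r ?rip_ge0.
Qed.

Lemma pos_form h : linear h -> sadj h -> (forall v, 0 <= rip (h v) v) ->
  real_form (fun u v => rip (h u) v).
Proof.
move=> lh sh h0; split=> [u v|k u v w|//]; first by rewrite sh ripC.
by rewrite lh !ripE.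
Qed.

(** Cauchy-Schwarz for the form <h u, v> at the pair v, h v gives |h v|^4 <= <h v, v> <h (h v), h
    v>, whose last factor is at most K |h v|^2. *)
Lemma pos_bound h K : linear h -> sadj h -> 0 <= K ->
  (forall v, 0 <= rip (h v) v <= K * rip v v) ->
  forall v, rip (h v) (h v) <= K * rip (h v) v.
Proof.
move=> lh sh K0 hK v.
have h0 w : 0 <= rip (h w) w by have /andP[] := hK w.
apply: sqr_le_cancel; first exact: mulr_ge0.
apply: le_trans (form_CS (pos_form lh sh h0) v (h v)) _.
rewrite -mulrA [leRHS]mulrCA; apply: ler_wpM2l => //.
by have /andP[] := hK (h v).
Qed.

(* The Riesz representation for the equivalent inner product <h u, v>. *)
Lemma coercive_inverse h (d : R) : blin h -> sadj h -> 0 < d ->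
  (forall v, d * rip v v <= rip (h v) v) ->
  exists k, [/\ blin k, sadj k, cancel k h & cancel h k].
Proof.
move=> [lh [K K0 KP]] sh d0 hd.
have h0 v : 0 <= rip (h v) v.
  by apply: le_trans (hd v); rewrite mulr_ge0 ?rip_ge0// ltW.
have hinj u v : h u = h v -> u = v.
  move=> huv; apply/eqP; rewrite -subr_eq0; apply/eqP/nrm0_eq0/eqP.
  have := hd (u - v); rewrite (linB lh) huv subrr (form0l rip_form) nrmE.
  by rewrite pmulr_rle0// => h1; rewrite -sqrf_eq0 eq_le h1 sqr_ge0.
have hK v : rip (h v) v <= (K + 1) * rip v v.
  have := rip_ge0 (h v - v); have := KP v.
  by rewrite !ripE (ripC v (h v)); have := rip_ge0 v; nra.
(* The two forms are equivalent: coercivity makes a Cauchy sequence for <h u, v> Cauchy in norm, and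
   [hK] turns norm convergence back. *)
have fc : form_complete (fun u v => rip (h u) v) setT.
  move=> u_ _ uc.
  have [|u _ uu] := closed_form_complete closedT (fun n => I : setT (u_ n)).
    move=> e e0; have [N NP] := uc _ (mulr_gt0 d0 e0).
    exists N => m n mN nN; have := le_trans (hd _) (NP _ _ mN nN).
    by rewrite ler_pM2l.
  exists u => // e e0.
  have K1 : 0 < K + 1 by rewrite ltr_wpDl.
  have [N NP] := uu _ (divr_gt0 e0 K1).
  exists N => n nN; apply: le_trans (hK _) _.
  by rewrite mulrC -ler_pdivlMr// NP.
have /choice[k kP] : forall v, exists w, forall u, rip u v = rip (h u) w.
  move=> v; have [//||||w _ wP] := @riesz _ _ _ (pos_form lh sh h0) setT
    (fun u => rip u v) (rip v v / d) _ fc.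
  - by move=> k u w _ _; rewrite !ripE.
  - by rewrite divr_ge0 ?rip_ge0// ltW.
  - move=> u _; apply: le_trans (rip_CS _ _) _.
    rewrite mulrC -mulrA ler_wpM2l ?rip_ge0// mulrC ler_pdivlMr// mulrC.
    exact: hd.
  - by exists w => u; apply: wP.
have hk : cancel k h by move=> v; apply: ripI => u; rewrite -sh -kP.
exists k; split=> //.
- split; first by move=> a u v; apply: hinj; rewrite lh !hk.
  exists (d ^- 2) => [|v]; first by rewrite invr_ge0 exprn_ge0// ltW.
  rewrite mulrC ler_pdivlMr ?exprn_gt0//.
  (* With V = |v|^2, X = |k v|^2 and Y = <v, k v>, the bounds d X <= Y and Y^2 <= V X give d^2 X <=
     V. *)
  have := hd (k v); rewrite hk => h1.
  have := rip_CS v (k v); move: (rip_ge0 v) (rip_ge0 (k v)) h1.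
  move: (rip v v) (rip (k v) (k v)) (rip v (k v)) => V X Y V0 X0 h1 h2.
  apply: sqr_le_cancel; first by rewrite ?mulr_ge0 ?sqr_ge0.
  have : (d * X) ^+ 2 <= Y ^+ 2.
    by rewrite ler_sqr ?nnegrE ?mulr_ge0 ?(ltW d0)//; nra.
  by move=> h3; have := le_trans h3 h2; have := sqr_ge0 d; nra.
- by move=> u v; rewrite -{1}(hk v) -sh hk.
- by move=> v; apply: hinj; rewrite hk.
Qed.

Lemma com_inverse T h k : cancel k h -> cancel h k -> com T h -> com T k.
Proof. by move=> hk kh Th v; rewrite -{1}(kh (T (k v))) -Th hk. Qed.

(** * Orthogonal projections on closed subspaces *)

Definition closed_subspace (G : set H) :=
  [/\ closed G, G 0 & forall k u v, G u -> G v -> G (k *: u + v)].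

(** The vector p v represents u |-> <u, v> restricted to G. *)
Lemma projection_ex G : closed_subspace G ->
  exists p, [/\ blin p, sadj p, forall v, G (p v) & forall v, G v -> p v = v].
Proof.
move=> [cG G0 GP].
have GB u v : G u -> G v -> G (u - v).
  by move=> Gu Gv; rewrite addrC -scaleN1r; apply: GP.
have /choice[p pP] : forall v, exists w, G w /\ forall u, G u -> rip u v = rip u w.
  move=> v; have [||||w Gw wP] := @riesz _ _ _ rip_form G (fun u => rip u v)
    (rip v v) _ (closed_form_complete cG).
  - by split=> // k; apply: GP.
  - by move=> k u w _ _; rewrite !ripE.
  - exact: rip_ge0.
  - by move=> u _; apply: le_trans (rip_CS _ _) _; rewrite mulrC.
  - by exists w.
have Gp v : G (p v) by case: (pP v).
have {}pP u v : G u -> rip u v = rip u (p v) by case: (pP v) => _; apply.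
have uni u v : G u -> G v -> (forall w, G w -> rip w u = rip w v) -> u = v.
  move=> Gu Gv uv; apply/eqP; rewrite -subr_eq0; apply/eqP/nrm0_eq0/eqP.
  rewrite -sqrf_eq0 -nrmE (formBr rip_form) uv ?subrr//; exact: GB.
have pid v : G v -> p v = v.
  by move=> Gv; apply: uni => // w Gw; rewrite -pP.
have sp : sadj p.
  by move=> u v; rewrite (pP (p u))// (ripC u) (pP (p v))// ripC.
exists p; split=> //; split.
  move=> k u v; apply: uni => //; first exact: GP.
  move=> w Gw; rewrite -pP// !ripE ripZr ripZr; congr (_ + _); last exact: pP.
  by rewrite -pP// -[_ *: w]addr0; exact: GP.
exists 1 => // v; rewrite mul1r -pP// ripC.
apply: sqr_le_cancel; first exact: rip_ge0.
have := rip_CS v (p v); rewrite (ripC v) pP//.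
Qed.

(** Invariance of G under T means p T p = T p; invariance under the adjoint gives, after taking
    adjoints, p T p = p T. *)
Lemma com_projection G p T T' : sadj p -> (forall v, G (p v)) ->
  (forall v, G v -> p v = v) -> (forall u v, rip (T u) v = rip u (T' v)) ->
  (forall v, G v -> G (T v)) -> (forall v, G v -> G (T' v)) -> com T p.
Proof.
move=> sp Gp pid TT' GT GT' v; apply: ripI => u.
rewrite -(pid (T (p v))); last exact/GT/Gp.
rewrite -sp ripC TT' sp (pid (T' _)); last exact/GT'/Gp.
by rewrite -TT' ripC sp.
Qed.

(** * Square roots and spectral cuts *)

Lemma small_le (a c C : R) : 0 <= C ->
  (forall e : R, 0 < e -> a <= c + e * C) -> a <= c.
Proof.
move=> C0 h; rewrite leNgt; apply/negP => ca.
have C1 : 0 < C + 1 by rewrite ltr_wpDl.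
have := h ((a - c) / (C + 1)) ltac:(by rewrite divr_gt0// subr_gt0).
rewrite -lerBlDl mulrAC ler_pdivlMr// mulrDr mulr1.
by rewrite gerDl leNgt subr_gt0 ca.
Qed.

Lemma small_eq (u v : H) (C : R) : 0 <= C ->
  (forall e : R, 0 < e -> nrm (u - v) <= e * C) -> u = v.
Proof.
move=> C0 h; apply/eqP; rewrite -subr_eq0; apply/eqP/nrm0_eq0/eqP.
rewrite eq_le nrm_ge0 andbT; apply: (small_le C0) => e e0.
by rewrite add0r h.
Qed.

Lemma nrmZc (k : R[i]) u : nrm (k *: u) = complex.Re `|k| * nrm u.
Proof.
rewrite {1}/nrm normrZ normE.
by case: `|k| => a b /=; rewrite mulr0 subr0.
Qed.

Lemma Re_norm_ge0 (k : R[i]) : 0 <= complex.Re `|k|.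
Proof. by rewrite normc_def /= sqrtr_ge0. Qed.

Lemma blin_nrm b (K : R) : linear b -> (forall v, nrm (b v) <= K * nrm v) ->
  blin b.
Proof.
move=> lb bK; split=> //; exists (K ^+ 2) => [|v]; first exact: sqr_ge0.
rewrite !nrmE -exprMn ler_sqr ?nnegrE ?nrm_ge0// (le_trans _ (bK v))//.
exact: nrm_ge0.
Qed.

Lemma nrm_blin b : blin b -> exists2 K, 0 <= K & forall v, nrm (b v) <= K * nrm v.
Proof.
move=> [lb [K K0 KP]]; exists (Num.sqrt K) => [|v]; first exact: sqrtr_ge0.
rewrite -ler_sqr ?nnegrE ?mulr_ge0 ?sqrtr_ge0 ?nrm_ge0//.
by rewrite exprMn sqr_sqrtr// -!nrmE.
Qed.

Lemma nrm_cauchy_cvg (u_ : nat -> H) :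
  (forall e : R, 0 < e -> exists N, forall n, (N <= n)%N -> nrm (u_ n - u_ N) <= e) ->
  exists u, forall e : R, 0 < e ->
    exists N, forall n, (N <= n)%N -> nrm (u_ n - u) <= e.
Proof.
move=> uc; have [|u _ uu] := closed_form_complete closedT (fun n => I : setT (u_ n)).
  move=> e e0; have e1 : 0 < Num.sqrt e / 2 by rewrite divr_gt0// sqrtr_gt0.
  have [N NP] := uc _ e1; exists N => m n mN nN.
  rewrite nrmE -[leRHS]sqr_sqrtr ?(ltW e0)// ler_sqr ?nnegrE ?nrm_ge0 ?sqrtr_ge0//.
  have := nrmD (u_ m - u_ N) (- (u_ n - u_ N)); rewrite nrmN opprB addrA subrK.
  have := NP _ mN; have := NP _ nN; lra.
exists u => e e0; have [N NP] := uu _ (exprn_gt0 2 e0).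
exists N => n nN; have := NP _ nN.
by rewrite nrmE ler_sqr ?nnegrE ?nrm_ge0 ?(ltW e0).
Qed.

(* With w = 1 - A, the iteration y |-> (w + y^2) / 2 converges to 1 - A^(1/2).
   Its increments are dominated by those of the scalar iteration r, that is, the
   case w = 1, so the convergence is uniform on bounded sets. *)
Section SquareRoot.
Context (w : H -> H) (lw : linear w) (sw : sadj w).
Hypothesis w1 : forall v, nrm (w v) <= nrm v.

Let y n := iter n (fun y v => (1 / 2)%:C *: (w v + y (y v))) (fun=> 0).
Let r n : R := iter n (fun r => (1 + r ^+ 2) / 2) 0.

Let yS n v : y n.+1 v = (1 / 2)%:C *: (w v + y n (y n v)). Proof. by []. Qed.
Let rS n : r n.+1 = (1 + r n ^+ 2) / 2. Proof. by []. Qed.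

Let ylin n : linear (y n).
Proof.
elim: n => [|n IH] k u v; first by rewrite /y /= scaler0 addr0.
rewrite !yS lw !IH addrACA -scalerDr [LHS]scalerDr; congr (_ + _).
by rewrite !scalerA mulrC.
Qed.

Let ysadj n : sadj (y n).
Proof.
elim: n => [|n IH] u v; first by rewrite /y /= !ripE.
by rewrite !yS !ripE sw !IH.
Qed.

Let ycom n T : linear T -> com T w -> com T (y n).
Proof.
move=> lT Tw; elim: n => [|n IH] v; first by rewrite /y /= lin0.
by rewrite !yS linZ// linD// Tw !IH.
Qed.

Let r01 n : 0 <= r n <= 1.
Proof.
elim: n => [|n /andP[r0 r1]]; first by rewrite /r /= lexx ler01.
by rewrite rS; apply/andP; split; nra.
Qed.

Let rle n : r n <= r n.+1.
Proof. by rewrite rS; have := sqr_ge0 (1 - r n); nra. Qed.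

Let ynrm n v : nrm (y n v) <= r n * nrm v.
Proof.
elim: n v => [|n IH] v; first by rewrite mul0r /y /= -(scale0r v) nrmZc normr0 mul0r.
rewrite yS rS nrmZ ger0_norm; last lra.
have := nrmD (w v) (y n (y n v)); have := w1 v; have := IH v; have := IH (y n v).
have /andP[] := r01 n; have := nrm_ge0 v; nra.
Qed.

(** The maps [y n] commute, being polynomials in w. Hence y_{n+2} - y_{n+1} is half of (y_{n+1} -
    y_n)(y_{n+1} + y_n), and the scalars r_n satisfy the same identity. *)
Let ystep n v : nrm (y n.+1 v - y n v) <= (r n.+1 - r n) * nrm v.
Proof.
elim: n v => [|n IH] v.
  by apply: le_trans (nrmD _ _) _; rewrite nrmN; have := ynrm 1 v; have := ynrm 0 v;
    rewrite /r /=; nra.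
have comm : y n.+1 (y n v) = y n (y n.+1 v).
  by apply: ycom => // x; rewrite [RHS]ycom.
have -> : y n.+2 v - y n.+1 v =
    (1 / 2)%:C *: (y n.+1 (y n.+1 v + y n v) - y n (y n.+1 v + y n v)).
  rewrite 2!yS -scalerBr opprD addrACA subrr add0r; congr (_ *: _).
  by rewrite !(linD (ylin _)) comm opprD addrA addrK.
rewrite nrmZ ger0_norm; last lra.
have := IH (y n.+1 v + y n v); have := nrmD (y n.+1 v) (y n v).
have := ynrm n v; have := ynrm n.+1 v; have := rle n.
rewrite (rS n.+1).
have := nrm_ge0 v; have /andP[] := r01 n; have /andP[] := r01 n.+1.
have -> : (1 + r n.+1 ^+ 2) / 2 - r n.+1 = (r n.+1 - r n) * (r n.+1 + r n) / 2.
  by rewrite [in - r n.+1]rS; field.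
nra.
Qed.

Let ydiff n j v : nrm (y (j + n)%N v - y n v) <= (r (j + n)%N - r n) * nrm v.
Proof.
elim: j => [|j IH].
  by rewrite add0n !subrr mul0r -(scale0r v) nrmZc normr0 mul0r.
have := nrmD (y (j + n).+1 v - y (j + n)%N v) (y (j + n)%N v - y n v).
rewrite addrA subrK addSn; have := ystep (j + n) v; lra.
Qed.

(** The tails sup r - r_N bound the increments of [y] relative to |v|, so a single index serves all
    v. This uniformity lets the properties of [y n] pass to the limit. *)
Let limit_approx : exists s : H -> H, forall e : R, 0 < e -> exists n,
  forall v, nrm (y n v - s v) <= e * nrm v /\
            nrm (y n.+1 v - y n v) <= e * nrm v.
Proof.
pose S := range r; have hS : has_sup S.
  split; first by exists (r 0%N), 0%N.
  by exists 1 => _ [n _ <-]; case/andP: (r01 n).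
have rS' n : r n <= sup S by apply: ub_le_sup; [exact: hS.2|exists n].
have rN (e : R) : 0 < e -> exists N, sup S - r N <= e.
  move=> e0; have [_ [N _ <-] h] := sup_adherent e0 hS.
  by exists N; lra.
have diff N n v : (N <= n)%N -> nrm (y n v - y N v) <= (sup S - r N) * nrm v.
  move=> Nn; have := ydiff N (n - N) v; rewrite subnK//.
  have := rS' n; have := nrm_ge0 v; nra.
have /choice[s sP] : forall v, exists u, forall e : R, 0 < e ->
    exists N, forall n, (N <= n)%N -> nrm (y n v - u) <= e.
  move=> v; apply: nrm_cauchy_cvg => e e0.
  have v1 : 0 < nrm v + 1 by have := nrm_ge0 v; lra.
  have [N NP] := rN _ (divr_gt0 e0 v1); exists N => n Nn.
  apply: le_trans (diff _ _ v Nn) _.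
  rewrite ler_pdivlMr// in NP; have := nrm_ge0 v; have := rS' N; nra.
exists s => e e0; have [N NP] := rN _ e0; exists N => v; split; last first.
  by have := diff _ _ v (leqnSn N); have := nrm_ge0 v; nra.
apply: (@small_le _ _ 1) => // d d0; rewrite mulr1.
have [n nP] := sP v d d0.
have := nP _ (leq_maxl n N); have := diff _ _ v (leq_maxr n N).
set m := maxn n N => h1 h2.
have := nrmD (- (y m v - y N v)) (y m v - s v).
rewrite nrmN opprB addrA subrK; have := nrm_ge0 v; nra.
Qed.

Lemma sqrt_iteration : exists s : H -> H, [/\ linear s, sadj s,
  forall v, nrm (s v) <= nrm v,
  forall v, w v + s (s v) = 2%:R *: s v &
  forall T, blin T -> com T w -> com T s].
Proof.
have [s sP] := limit_approx.
have yv n v : nrm (y n v) <= nrm v.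
  apply: le_trans (ynrm n v) _; have /andP[_] := r01 n; have := nrm_ge0 v; nra.
have s1 v : nrm (s v) <= nrm v.
  apply: (small_le (nrm_ge0 v)) => e e0; have [n /(_ v)[h _]] := sP e e0.
  have := nrmD (y n v) (- (y n v - s v)); rewrite nrmN opprB addrC subrK.
  have := yv n v; lra.
exists s; split=> //.
- move=> k u v.
  pose C := nrm (k *: u + v) + complex.Re `|k| * nrm u + nrm v.
  have C0 : 0 <= C by rewrite /C !addr_ge0 ?mulr_ge0 ?nrm_ge0 ?Re_norm_ge0.
  apply: (small_eq C0) => e e0; have [n nP] := sP e e0.
  have [h1 _] := nP (k *: u + v); have [h2 _] := nP u; have [h3 _] := nP v.
  have -> : s (k *: u + v) - (k *: s u + s v) = - (y n (k *: u + v) - s (k *: u + v))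
      + (k *: (y n u - s u) + (y n v - s v)).
    rewrite ylin scalerBr [_ - k *: _ + _]addrACA -opprD.
    by rewrite [- (_ - _)]opprB addrA subrK.
  apply: le_trans (nrmD _ _) _; rewrite nrmN.
  have := nrmD (k *: (y n u - s u)) (y n v - s v); rewrite nrmZc /C.
  have := Re_norm_ge0 k; nra.
- move=> u v; apply/eqP; rewrite -subr_eq0 -normr_eq0 eq_le normr_ge0 andbT.
  have C0 : 0 <= 2 * nrm u * nrm v by rewrite !mulr_ge0 ?nrm_ge0.
  apply: (small_le C0) => e e0; have [n nP] := sP e e0.
  have [h1 _] := nP u; have [h2 _] := nP v.
  have -> : rip (s u) v - rip u (s v) =
      rip u (y n v - s v) - rip (y n u - s u) v.
    by rewrite !ripE ysadj; ring.
  apply: le_trans (ler_normB _ _) _.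
  have := rip_le_nrm u (y n v - s v); have := rip_le_nrm (y n u - s u) v.
  have := nrm_ge0 u; have := nrm_ge0 v; nra.
(* The constant 6 adds up 2 + 2 from the two doubled differences and 1 + 1 from replacing s (s v) by
   y_n (y_n v). *)
- move=> v; apply: (@small_eq _ _ (6 * nrm v)).
    by rewrite mulr_ge0 ?nrm_ge0.
  move=> e e0; have [n nP] := sP e e0.
  have [h1 h2] := nP v; have [h3 _] := nP (s v).
  have h4 := yv n (y n v - s v).
  have -> : w v + s (s v) - 2%:R *: s v =
     (2%:R *: (y n.+1 v - y n v) + 2%:R *: (y n v - s v)) -
     ((y n (s v) - s (s v)) + y n (y n v - s v)).
    rewrite -scalerDr addrA subrK (linB (ylin n)).
    rewrite [X in _ = _ - X]addrC addrA subrK opprB scalerBr yS scalerA.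
    have -> : 2%:R * (1 / 2)%:C = 1 :> R[i].
      by rewrite -[2%:R](rmorph_nat (real_complex R)) -rmorphM mul1r divff.
    by rewrite scale1r [RHS]addrAC addrACA subrr addr0.
  have n2 x : nrm (2%:R *: x) = 2 * nrm x.
    by rewrite nrmZc normr_nat -(rmorph_nat (real_complex R)).
  apply: le_trans (nrmD _ _) _; rewrite nrmN.
  have := nrmD (2%:R *: (y n.+1 v - y n v)) (2%:R *: (y n v - s v)).
  have := nrmD (y n (s v) - s (s v)) (y n (y n v - s v)).
  rewrite !n2; have := s1 v; nra.
- move=> T bT Tw v; have [K K0 KP] := nrm_blin bT.
  apply: (@small_eq _ _ (K * nrm v + nrm (T v))).
    by rewrite addr_ge0 ?mulr_ge0 ?nrm_ge0.
  move=> e e0; have [n nP] := sP e e0.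
  have [h1 _] := nP v; have [h2 _] := nP (T v).
  have -> : T (s v) - s (T v) = (y n (T v) - s (T v)) - T (y n v - s v).
    by rewrite (linB bT.1) (ycom n bT.1 Tw) opprB [RHS]addrC addrA subrK.
  apply: le_trans (nrmD _ _) _; rewrite nrmN.
  have := KP (y n v - s v); nra.
Qed.

End SquareRoot.

(** The root is 1 - s for the fixed point s of the iteration with w = 1 - A: from w + s^2 = 2 s one
    gets (1 - s)^2 = 1 - w = A. As s is a contraction, 0 <= 1 - s <= 2. *)
Lemma sqrt_op A : blin A -> sadj A ->
  (forall v, 0 <= rip (A v) v <= rip v v) ->
  exists h, [/\ blin h, sadj h, forall v, 0 <= rip (h v) v <= 2 * rip v v,
    forall v, h (h v) = A v & forall T, blin T -> com T A -> com T h].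
Proof.
move=> bA sA A01; pose w v := v - A v.
have bw : blin w by apply: blin_sub blin_id bA.
have sw : sadj w by move=> u v; rewrite /w !ripE sA.
have w01 v : 0 <= rip (w v) v <= 1 * rip v v.
  by have /andP[] := A01 v; rewrite /w !ripE => ? ?; apply/andP; split; lra.
have w1 v : nrm (w v) <= nrm v.
  rewrite -ler_sqr ?nnegrE ?nrm_ge0// -!nrmE.
  have := pos_bound bw.1 sw ler01 w01 v; have /andP[] := w01 v; lra.
have [s [ls ss s1 sE sT]] := sqrt_iteration bw.1 sw w1.
have bs : blin s by apply: (blin_nrm (K := 1)) => // v; rewrite mul1r.
exists (fun v => v - s v); split.
- exact: blin_sub blin_id bs.
- by move=> u v; rewrite !ripE ss.
- move=> v; rewrite (formBl rip_form) nrmE.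
  have := rip_le_nrm (s v) v; rewrite ler_norml => /andP[].
  have := s1 v; have := nrm_ge0 v => v0 h1 h2 h3.
  by apply/andP; split; nra.
- move=> v; have := sE v; rewrite (linB ls) scaler_nat mulr2n /w => h.
  rewrite opprB addrA addrAC -(addrA v) -opprD -h.
  by rewrite opprD addrA subrK opprB addrC subrK.
- move=> T bT TA v; rewrite (linB bT.1) sT// => u.
  by rewrite /w (linB bT.1) TA.
Qed.

Lemma closed_kernel g : blin g -> closed_subspace [set v | g v = 0].
Proof.
move=> bg; have [lg _] := bg.
split => /=; [|exact: lin0|by move=> k u v gu gv; rewrite lg gu gv scaler0 addr0].
have /bounded_operatorP[_ cg] := bg.
apply: (closed_comp (f := g) (D := [set 0])) => [v _|]; first exact: cg.
by apply: accessible_closed_set1; apply: hausdorff_accessible; exact: norm_hausdorff.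
Qed.

(** Let d = b - c. Dividing by K makes d^2 / K^2 at most 1, so K h = |d| for its root h. On the
    kernel of K h - d one has d = |d| >= 0. The product of K h - d and K h + d is 0, so K h + d maps
    into that kernel; being self-adjoint, it vanishes on the orthogonal complement, where therefore
    d = -|d| <= 0. *)
Lemma spectral_cut b (c : R) : blin b -> sadj b ->
  exists e, [/\ blin e, sadj e & forall v, e (e v) = e v] /\
    [/\ forall T, blin T -> sadj T -> com T b -> com T e,
        forall v, c * rip (e v) (e v) <= rip (b (e v)) (e v) &
        forall v, rip (b (v - e v)) (v - e v) <= c * rip (v - e v) (v - e v)].
Proof.
move=> bb sb; pose d v := b v - c%:C *: v.
have bd : blin d by apply: blin_sub bb (blin_scale _ blin_id).
have sd : sadj d by move=> u v; rewrite /d !ripE sb.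
have [K0 K00 K0P] := nrm_blin bd.
pose K := K0 + 1; have Kgt : 0 < K by rewrite /K; lra.
have KP v : nrm (d v) <= K * nrm v.
  by apply: le_trans (K0P v) _; rewrite ler_wpM2r ?nrm_ge0// /K; lra.
pose A v := (K ^- 2)%:C *: d (d v).
have bA : blin A by apply: blin_scale; exact: blin_comp.
have sA : sadj A by move=> u v; rewrite /A (formZl rip_form) (formZr rip_form) !sd.
have AE v : rip (A v) v = (nrm (d v) / K) ^+ 2.
  by rewrite /A (formZl rip_form) sd nrmE exprMn exprVn mulrC.
have [v|h [bh sh h02 hh hT]] := sqrt_op bA sA.
  rewrite AE sqr_ge0 nrmE ler_sqr ?nnegrE ?nrm_ge0 ?divr_ge0 ?nrm_ge0 ?(ltW Kgt)//=.
  by rewrite ler_pdivrMr// mulrC.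
have hd : com d h by apply: hT => // v; rewrite /A (linZ bd.1).
pose g v := K%:C *: h v - d v.
have bg : blin g by apply: blin_sub bd; exact: blin_scale.
have [e [be se Ge eG]] := projection_ex (closed_kernel bg).
have ee v : e (e v) = e v by exact: eG.
exists e; split=> //; split.
- move=> T bT sT Tb.
  have Td : com T d by move=> v; rewrite /d (linB bT.1) (linZ bT.1) Tb.
  have Th : com T h.
    by apply: hT => // v; rewrite /A (linZ bT.1) !Td.
  have TG v : g v = 0 -> g (T v) = 0.
    rewrite /g -Th -Td -(linZ bT.1) -(linB bT.1) => ->; exact: lin0 bT.1.
  exact: (com_projection se Ge eG sT).
- move=> v; have /subr0_eq dE := Ge v.
  have := h02 (e v); have -> : b (e v) = d (e v) + c%:C *: e v by rewrite /d subrK.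
  by rewrite -dE (formDl rip_form) !(formZl rip_form) => /andP[h1 _]; nra.
move=> v; set f := v - e v.
have fG u : g u = 0 -> rip u f = 0.
  by move=> gu; rewrite /f !ripE -{2}(eG u)// se ee -se eG// subrr.
clearbody f.
have hf : K%:C *: h f + d f = 0.
  apply: ripI => u; rewrite (form0r rip_form).
  transitivity (rip (K%:C *: h u + d u) f).
    rewrite (formDl rip_form) (formDr rip_form) (formZl rip_form).
    by rewrite (formZr rip_form) sd sh.
  apply: fG; rewrite /g (linD bh.1) (linD bd.1) (linZ bh.1) (linZ bd.1) hh hd.
  rewrite scalerDr opprD addrA addrK /A !scalerA -!rmorphM /=.
  by rewrite -expr2 divff ?scale1r ?subrr// expf_neq0// gt_eqF.
have := h02 f; have -> : b f = d f + c%:C *: f by rewrite /d subrK.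
have -> : d f = - (K%:C *: h f) by apply/eqP; rewrite -addr_eq0 addrC hf.
rewrite (formDl rip_form) (formNl rip_form) !(formZl rip_form) => /andP[h1 _].
by nra.
Qed.

(** * Membership in a von Neumann algebra *)

(** The imaginary parts agree by the hypothesis at ['i *: v], where linearity of c enters. *)
Lemma rip_is_adjoint b c : linear c ->
  (forall u v, rip (b u) v = rip u (c v)) -> is_adjoint dot b c.
Proof.
move=> lc bc u v; apply/eqP; rewrite eq_complex !dot_Im bc (linZ lc) eqxx andbT.
by apply/eqP; exact: bc.
Qed.

Lemma is_adjoint_rip b c : is_adjoint dot b c ->
  forall u v, rip (b u) v = rip u (c v).
Proof. by move=> bc u v; rewrite /rip bc. Qed.

Lemma ripZi u v : rip ('i *: u) v = - rip u ('i *: v).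
Proof.
rewrite ripZl -(formNr rip_form) -scaleNr; congr (rip u (_ *: v)).
by apply/eqP; rewrite eq_complex /= oppr0 !eqxx.
Qed.

Lemma i2 (v : H) : 'i *: ('i *: v) = - v.
Proof. by rewrite scalerA -expr2 sqr_i scaleN1r. Qed.

Lemma mulr2n_inj (u v : H) : u *+ 2 = v *+ 2 -> u = v.
Proof.
move=> uv; apply: (@scalerI _ _ 2%:R); first by rewrite pnatr_eq0.
by rewrite !scaler_nat.
Qed.

Lemma mulr2n_addsub (u v : H) : u *+ 2 = (u + v) + (u - v).
Proof. by rewrite addrACA subrr addr0 mulr2n. Qed.

Section VonNeumann.
Context (M : set (H -> H)) (vM : von_neumann_algebra dot M).

Lemma vna_blin b : M b -> blin b.
Proof. by move=> /(vna_bounded vM)/bounded_operatorP. Qed.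

Lemma vna_adjoint b : M b -> exists2 c, M c & forall u v, rip (b u) v = rip u (c v).
Proof.
move=> Mb; have [c [bc h]] := adjoint_ex (vna_blin Mb).
exists c => //; apply: (vna_star vM Mb); exact: rip_is_adjoint bc.1 h.
Qed.

Definition commut (S : H -> H) := blin S /\ forall m, M m -> com S m.

Lemma commutP S : commutant M S <-> commut S.
Proof.
split=> -[bS h]; (split; first exact/bounded_operatorP).
  by move=> m /h Sm v; have := congr1 (@^~ v) Sm.
by move=> m Mm; apply/funext => v; exact: h.
Qed.

Lemma commut_add S T : commut S -> commut T -> commut (fun v => S v + T v).
Proof.
move=> [bS Sm] [bT Tm]; split; first exact: blin_add.
by move=> m Mm v; rewrite Sm// Tm// (linD (vna_blin Mm).1).
Qed.

Lemma commut_scale k S : commut S -> commut (fun v => k *: S v).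
Proof.
move=> [bS Sm]; split; first exact: blin_scale.
by move=> m Mm v; rewrite Sm// (linZ (vna_blin Mm).1).
Qed.

Lemma commut_sub S T : commut S -> commut T -> commut (fun v => S v - T v).
Proof.
move=> [bS Sm] [bT Tm]; split; first exact: blin_sub.
by move=> m Mm v; rewrite Sm// Tm// (linB (vna_blin Mm).1).
Qed.

Lemma commut_comp S T : commut S -> commut T -> commut (fun v => S (T v)).
Proof.
move=> [bS Sm] [bT Tm]; split; first exact: blin_comp bS bT.
by move=> m Mm v; rewrite Tm// Sm.
Qed.

Lemma commut_id : commut id.
Proof. by split=> //; exact: blin_id. Qed.

Lemma commut_adjoint S S' : commut S -> blin S' ->
  (forall u v, rip (S u) v = rip u (S' v)) -> commut S'.
Proof.
move=> [bS Sm] bS' SS'; split=> // m Mm v; apply: ripI => u.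
have [m' Mm' mm'] := vna_adjoint Mm.
by rewrite -SS' ripC mm' -Sm// ripC SS' ripC [RHS]ripC mm' ripC.
Qed.

Lemma vna_mem_sadj T : blin T -> (forall S, commut S -> sadj S -> com T S) -> M T.
Proof.
move=> bT TS; rewrite -(vna_bicommutant vM); split; first exact/bounded_operatorP.
move=> S /commutP cS; have [bS _] := cS; apply/funext => v /=.
have [S' [bS' SS']] := adjoint_ex bS.
have cS' := commut_adjoint cS bS' SS'.
have SS2 u w : rip (S' u) w = rip u (S w) by rewrite ripC -SS' ripC.
have h1 : com T (fun v => S v + S' v).
  by apply: TS; [exact: commut_add|move=> u w; rewrite !ripE SS' SS2 addrC].
have h2 : com T (fun v => 'i *: (S v - S' v)).
  apply: TS; first by apply: commut_scale; exact: commut_sub.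
  move=> u w; rewrite ripZi -[RHS]opprK; congr (- _); rewrite -ripZi.
  by rewrite !ripE SS' SS2 (linZ bS.1) (linZ bS'.1) !ripZi; ring.
have lT := bT.1.
have h3 : T (S v) + T (S' v) = S (T v) + S' (T v) by rewrite -(linD lT) h1.
have h4 : T (S v) - T (S' v) = S (T v) - S' (T v).
  have := h2 v; rewrite (linZ lT) => /(congr1 ( *:%R 'i)); rewrite !i2 => /oppr_inj.
  by rewrite (linB lT).
by apply: mulr2n_inj; rewrite (mulr2n_addsub _ (T (S' v))) h3 h4 -mulr2n_addsub.
Qed.

(* The Cayley transform of a self-adjoint S in the commutant is a unitary of
   the commutant from which S can be recovered. *)
Lemma vna_mem T : blin T ->
  (forall U, unitary dot U -> commutant M U -> com T U) -> M T.
Proof.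
move=> bT TU; apply: vna_mem_sadj => // S cS sS; have [bS Sm] := cS.
(* The inverse of N is Z = 2 (1 + S^2)^-1. With P = 1 - Z and Q = S Z, the Cayley transform (S -
   i)(S + i)^-1 equals P - i Q. *)
pose N v := (1 / 2)%:C *: (v + S (S v)).
have cN : commut N.
  by apply: commut_scale; apply: commut_add commut_id _; exact: commut_comp.
have sN : sadj N.
  by move=> u v; rewrite /N (formZl rip_form) (formZr rip_form) !ripE !sS.
have [||Z [bZ sZ ZN NZ]] := @coercive_inverse N (1 / 2) cN.1 sN.
- by lra.
- by move=> v; rewrite /N (formZl rip_form) !ripE sS; have := rip_ge0 (S v); lra.
have cZ : commut Z.
  split=> // m Mm v; apply/esym; apply: (com_inverse ZN NZ) => x.
  by rewrite cN.2.
have SZ : com S Z.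
  apply: (com_inverse ZN NZ) => x; rewrite /N (linZ bS.1) (linD bS.1) //.
pose P v := v - Z v; pose Q v := S (Z v).
have bP : blin P := blin_sub blin_id bZ.
have bQ : blin Q := blin_comp bS bZ.
have cP : commut P := commut_sub commut_id cZ.
have cQ : commut Q := commut_comp cS cZ.
have sP : sadj P by move=> u v; rewrite /P !ripE sZ.
have sQ : sadj Q by move=> u v; rewrite /Q sS sZ SZ.
have PQ : com P Q.
  by move=> v; rewrite /P /Q (linB bZ.1) (linB bS.1) -SZ.
have ZSS v : Z v + S (S (Z v)) = v *+ 2.
  rewrite -{3}(ZN v) /N -scaler_nat -(rmorph_nat (real_complex R)) scalerA.
  by rewrite -rmorphM mul1r divff ?scale1r.
have PPQQ v : P (P v) + Q (Q v) = v.
  rewrite /P /Q (linB bZ.1) -SZ opprB -addrA.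
  by rewrite [_ + S _]addrAC ZSS mulr2n addrK subrK.
pose U v := P v - 'i *: Q v; pose U' v := P v + 'i *: Q v.
have bU : blin U := blin_sub bP (blin_scale 'i bQ).
have bU' : blin U' := blin_add bP (blin_scale 'i bQ).
have PQi v : P ('i *: Q v) = 'i *: Q (P v) by rewrite (linZ bP.1) PQ.
have QQi v : Q ('i *: Q v) = 'i *: Q (Q v) by rewrite (linZ bQ.1).
have UK : cancel U U'.
  move=> v; rewrite /U /U' (linB bP.1) (linB bQ.1) PQi QQi scalerBr i2 opprK.
  by rewrite addrA subrK PPQQ.
have U'K : cancel U' U.
  move=> v; rewrite /U /U' (linD bP.1) (linD bQ.1) PQi QQi scalerDr i2.
  by rewrite opprD opprK addrA addrK PPQQ.
have UU' u v : rip (U u) v = rip u (U' v).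
  rewrite /U /U' (formBl rip_form) (formDr rip_form) sP ripZi opprK.
  by rewrite sQ (linZ bQ.1).
have cU : commut U := commut_sub cP (commut_scale 'i cQ).
have TUc : com T U.
  apply: TU; last exact/commutP.
  split; first exact/bounded_operatorP.
  by exists U'; split=> //; exact: rip_is_adjoint bU'.1 UU'.
have TU'c : com T U' := com_inverse U'K UK TUc.
have lT := bT.1.
(* P is half the sum of U and its inverse U', and i Q is half of U' - U. *)
have TP : com T P.
  move=> v; apply: mulr2n_inj.
  rewrite (mulr2n_addsub _ ('i *: T (Q v))) (mulr2n_addsub (P _) ('i *: Q (T v))).
  rewrite -(linZ lT) -(linD lT) -(linB lT).
  by have := TUc v; have := TU'c v; rewrite /U /U' => -> ->.
have TZ : com T Z.
  move=> v; have := TP v; rewrite /P (linB lT) => /addrI; exact: oppr_inj.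
have TQ : com T Q.
  move=> v; have := TU'c v; rewrite /U' (linD lT) (linZ lT) TP => /addrI.
  by move=> /(congr1 ( *:%R 'i)); rewrite !i2 => /oppr_inj.
(* S is recovered as Q N, since Z N = 1. *)
by move=> v; have := TQ (N v); rewrite /Q -TZ NZ.
Qed.

Lemma vna_comp b c : M b -> M c -> M (fun v => b (c v)).
Proof. by move=> Mb Mc; have := vna_mul vM Mb Mc. Qed.

Lemma vna_id : M id.
Proof. by apply: vna_mem => [|U _ _ v //]; exact: blin_id. Qed.

Lemma vna_sub b c : M b -> M c -> M (fun v => b v - c v).
Proof.
move=> Mb Mc; have := vna_linear vM (-1) Mc Mb; congr M.
by apply/funext => v; rewrite scaleN1r addrC.
Qed.

Lemma projectionsP p : projections dot M p <->
  [/\ M p, forall v, p (p v) = p v & sadj p].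
Proof.
split=> -[Mp pp sp]; split => //.
- by move=> v; have := congr1 (@^~ v) pp.
- exact: is_adjoint_rip.
- exact/funext.
- by apply: rip_is_adjoint; first exact: (vna_blin Mp).1.
Qed.

Lemma projection_ortho_compl p : projections dot M p ->
  projections dot M (ortho_compl p).
Proof.
move=> /projectionsP[Mp pp sp]; apply/projectionsP; split.
- exact: vna_sub vna_id Mp.
- by move=> v; rewrite /ortho_compl (linB (vna_blin Mp).1) pp subrr subr0.
- by move=> u v; rewrite /ortho_compl !ripE sp.
Qed.

Lemma projection_pythagoras p v : projections dot M p ->
  rip v v = rip (p v) (p v) + rip (ortho_compl p v) (ortho_compl p v).
Proof.
move=> /projectionsP[Mp pp sp]; rewrite /ortho_compl !ripE (ripC v (p v)) !sp !pp.
by ring.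
Qed.

Lemma nrm_projection p v : projections dot M p -> nrm (p v) <= nrm v.
Proof.
move=> /(projection_pythagoras v) h.
by rewrite -ler_sqr ?nnegrE ?nrm_ge0// -!nrmE h lerDl rip_ge0.
Qed.

(** The order of R[i] also requires <b v, v> to be real: self-adjointness makes its imaginary part
    equal to its own opposite. *)
Lemma positive_partP b : M b -> sadj b -> (forall v, 0 <= rip (b v) v) ->
  positive_part dot M b.
Proof.
move=> Mb sb b0; split=> // v; rewrite linear0l lecE /= b0 andbT dot_Im.
apply/eqP; have : rip (b v) ('i *: v) = - rip (b v) ('i *: v).
  by rewrite {1}sb (linZ (vna_blin Mb).1) -ripZi ripC.
by lra.
Qed.

(** * Spectral cut of an affiliated operator *)

Definition pair_form (q r : H * H) : R := rip q.1 r.1 + rip q.2 r.2.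

Lemma pair_form_form : real_form pair_form.
Proof.
split=> [[u1 u2] [v1 v2]|k [u1 u2] [v1 v2] [w1 w2]|[u1 u2]]; rewrite /pair_form /=.
- by rewrite ripC (ripC u2).
- by rewrite !ripE; ring.
- by rewrite addr_ge0 ?rip_ge0.
Qed.

Lemma closed_pair_complete (G : set (H * H)) : closed G ->
  form_complete pair_form G.
Proof.
move=> cG u_ Gu uc.
have le1 q : rip q.1 q.1 <= pair_form q q by rewrite /pair_form lerDl rip_ge0.
have le2 q : rip q.2 q.2 <= pair_form q q by rewrite /pair_form lerDr rip_ge0.
have [|u _ uu] := closed_form_complete closedT (fun n => I : setT (u_ n).1).
  move=> e e0; have [N NP] := uc e e0; exists N => m n mN nN.
  exact: le_trans (le1 (u_ m - u_ n)) (NP _ _ mN nN).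
have [|v _ vv] := closed_form_complete closedT (fun n => I : setT (u_ n).2).
  move=> e e0; have [N NP] := uc e e0; exists N => m n mN nN.
  exact: le_trans (le2 (u_ m - u_ n)) (NP _ _ mN nN).
exists (u, v).
  have uv : u_ n @[n --> \oo] --> (u, v).
    have -> : u_ = fun n => ((u_ n).1, (u_ n).2) by apply/funext => n; case: (u_ n).
    by apply: cvg_pair; exact/rip_cvg.
  apply: closed_cvg cG _ _ uv; near=> n; exact: Gu.
move=> e e0; have e2 : 0 < e / 2 by lra.
have [N1 N1P] := uu _ e2; have [N2 N2P] := vv _ e2.
exists (maxn N1 N2) => n; rewrite geq_max => /andP[n1 n2].
by have := N1P _ n1; have := N2P _ n2; rewrite /pair_form /=; lra.
Unshelve. all: by end_near. Qed.

(* b is (1 + a^* a)^-1 and ab is a (1 + a^* a)^-1: the pair (b u, ab u) is the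
   orthogonal projection of (u, 0) on the graph of a. *)
Lemma resolvent_ex a : unbounded_operator a -> closed a -> affiliated dot M a ->
  exists b ab : H -> H, [/\ M b, sadj b, forall u, a (b u, ab u) &
    forall u q, a q -> rip q.1 u = rip q.1 (b u) + rip q.2 (ab u)].
Proof.
move=> [a0 aL aF] ca aM.
have aZ k q : a q -> a (k *: q) by move=> aq; rewrite -[k *: q]addr0; exact: aL.
have aB q r : a q -> a r -> a (q - r).
  by move=> aq ar; rewrite addrC -scaleN1r; exact: aL.
have /choice[g gP] : forall u, exists r, a r /\
    forall q, a q -> rip q.1 u = pair_form q r.
  move=> u; have [||||r ar rP] := @riesz _ _ _ pair_form_form a
    (fun q => rip q.1 u) (rip u u) _ (closed_pair_complete ca).
  - by split=> // k q r; apply: aL.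
  - by move=> k q r _ _; rewrite /= !ripE.
  - exact: rip_ge0.
  - move=> q _; apply: le_trans (rip_CS _ _) _.
    by rewrite mulrC ler_wpM2l ?rip_ge0// /pair_form lerDl rip_ge0.
  - by exists r.
(* Uniqueness of the projection on the graph; it yields both the linearity of g and its commutation
   with unitaries. *)
have uni u r : a r -> (forall q, a q -> rip q.1 u = pair_form q r) -> r = g u.
  move=> ar rP; have [ag gE] := gP u.
  have : pair_form (r - g u) (r - g u) = 0.
    have arg := aB _ _ ar ag.
    by rewrite (formBr pair_form_form) -rP// -gE// subrr.
  rewrite /pair_form => /eqP; rewrite paddr_eq0 ?rip_ge0// !nrmE !sqrf_eq0.
  move=> /andP[/eqP/nrm0_eq0 h1 /eqP/nrm0_eq0 h2].
  by apply/eqP; rewrite -subr_eq0; apply/eqP; case: (r - g u) h1 h2 => /= ? ? -> ->.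
have glin : linear g.
  move=> k u v; apply/esym/uni; first by apply: aL; [case: (gP u)|case: (gP v)].
  move=> q aq; have [_ gu] := gP u; have [_ gv] := gP v.
  rewrite !ripE (formDr pair_form_form) -gv//; congr (_ + _).
  rewrite ripZr /pair_form /= !ripZr.
  by have := gu _ (aZ k^* q aq).
pose b u := (g u).1; pose ab u := (g u).2.
have ag u : a (b u, ab u) by have [+ _] := gP u; rewrite /b /ab; case: (g u).
have gE u q : a q -> rip q.1 u = rip q.1 (b u) + rip q.2 (ab u).
  by move=> aq; have [_ ->] := gP u.
have sb : sadj b.
  move=> u v; rewrite (gE v _ (ag u)) (ripC u) (gE u _ (ag v)) /=.
  by rewrite ripC (ripC (ab u)).
have lb : linear b by move=> k u v; rewrite /b glin.
have bb : blin b.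
  apply: (blin_nrm (K := 1)) => // u; rewrite mul1r.
  apply: sqr_le_cancel; first exact: nrm_ge0.
  have := gE u _ (ag u); rewrite /= => h.
  have := rip_le_nrm (b u) u; rewrite ler_norml => /andP[_].
  by rewrite h -nrmE; have := rip_ge0 (ab u); lra.
exists b, ab; split=> //; apply: vna_mem => // U uU cU.
have /commutP[bU _] := cU; have [_ [U' [adU UK U'K]]] := uU.
have aU := aM U uU cU.
(* Affiliation makes the graph invariant under U and its inverse, so U applied to both components of
   g u has the property that characterizes g (U u). *)
move=> u; suff h : (U (b u), U (ab u)) = g (U u) by rewrite {1}/b -h.
apply: uni; first by apply: (aU _ _).1; exact: ag.
move=> [w w'] aww; have aU' : a (U' w, U' w') by apply: (aU _ _).2; rewrite !U'K.
have adj x y : rip (U' x) y = rip x (U y).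
  by rewrite ripC -(is_adjoint_rip adU) ripC.
by rewrite /pair_form /= -!adj; exact: gE aU'.
Qed.

(** Since b = (1 + a^* a)^-1, the condition |a| <= s corresponds to b >= c with c = (1 + s^2)^-1.
    The third property expresses the lower bound of a off e without mentioning a on the range of 1 -
    e. *)
Lemma operator_cut a (s : R) : unbounded_operator a -> closed a ->
  affiliated dot M a -> 0 < s ->
  exists e, [/\ projections dot M e,
    forall v, exists2 w, a (e v, w) & nrm w <= s * nrm v &
    forall q (r : R), a q -> nrm q.2 <= r * nrm q.1 ->
      (1 + s ^+ 2) * nrm (ortho_compl e q.1) ^+ 2 <= (1 + r ^+ 2) * nrm q.1 ^+ 2].
Proof.
move=> ua ca aM s0; have [b [ab [Mb sb ag gE]]] := resolvent_ex ua ca aM.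
have bb := vna_blin Mb; pose c := (1 + s ^+ 2)^-1.
have s1 : 0 < 1 + s ^+ 2 by have := sqr_ge0 s; lra.
have c0 : 0 < c by rewrite invr_gt0.
have cs : c * (1 + s ^+ 2) = 1 by rewrite mulVf// gt_eqF.
have c1 : c <= 1 by have := sqr_ge0 s; nra.
have [e [[be se ee] [eT be_ge be_le]]] := spectral_cut c bb sb.
have Me : M e.
  apply: vna_mem_sadj => // S [bS Sm] sS v; apply/esym; apply: eT => //.
  exact: Sm.
have Pe : projections dot M e by apply/projectionsP.
have eb : com b e by apply: eT.
have bE u : rip (b u) u = rip (b u) (b u) + rip (ab u) (ab u) := gE u _ (ag u).
exists e; split=> // [v|[v w] r avw /= wr].
  (* B agrees with b on the range of e and is at least c, hence invertible. The solution u of b u =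
     e v puts e v in the domain of a, with image ab u. *)
  pose B v := b (e v) + ortho_compl e v.
  have bB : blin B by apply: blin_add (blin_comp bb be) (blin_sub blin_id be).
  have sB : sadj B.
    by move=> x y; rewrite /B /ortho_compl !ripE sb !se eb.
  have Bc x : c * rip x x <= rip (B x) x.
    have -> : rip (B x) x = rip (b (e x)) (e x) +
        rip (ortho_compl e x) (ortho_compl e x).
      rewrite /B (formDl rip_form); congr (_ + _); first by rewrite -se -eb ee.
      rewrite {2}/ortho_compl (formBr rip_form) -(se (ortho_compl e x)).
      by rewrite /ortho_compl (linB be.1) ee subrr (form0l rip_form) subr0.
    rewrite (projection_pythagoras x Pe); have := be_ge x.
    by have := rip_ge0 (ortho_compl e x); nra.
  have [k [bk sk kB Bk]] := coercive_inverse bB sB c0 Bc.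
  have ek : com e k.
    apply: (com_inverse kB Bk) => x.
    by rewrite /B /ortho_compl (linD be.1) (linB be.1) ee -eb ee.
  pose u := k (e v); have eu : e u = u by rewrite /u ek ee.
  have bu : b u = e v by rewrite -[RHS]kB -/u /B /ortho_compl eu subrr addr0.
  exists (ab u); first by rewrite -bu.
  have h1 := be_ge u; rewrite eu in h1.
  have h2 := rip_CS (b u) u; have h3 := bE u.
  have h4 : rip (b u) (b u) <= nrm v ^+ 2.
    by rewrite bu nrmE ler_sqr ?nnegrE ?nrm_ge0// nrm_projection.
  rewrite -ler_sqr ?nnegrE ?mulr_ge0 ?nrm_ge0 ?(ltW s0)// exprMn -nrmE.
  have Y0 : 0 <= rip (b u) u by rewrite h3 addr_ge0 ?rip_ge0.
  (* Cauchy-Schwarz and c |u|^2 <= <b u, u> give this bound. As <b u, u> = |b u|^2 + |ab u|^2, it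
     says |ab u| <= s |b u|. *)
  have h5 : rip (b u) u <= (1 + s ^+ 2) * rip (b u) (b u).
    apply: sqr_le_cancel; first by rewrite mulr_ge0 ?rip_ge0// ltW.
    apply: le_trans h2 _; rewrite [leRHS]mulrAC [leRHS]mulrC.
    by apply: ler_wpM2l; rewrite ?rip_ge0// -ler_pdivrMl.
  have := sqr_ge0 s; nra.
set f := ortho_compl e v.
have h1 : rip (b f) f <= c * nrm f ^+ 2 by rewrite -nrmE; exact: be_le.
have h2 : rip v f = nrm f ^+ 2.
  by rewrite -nrmE /f /ortho_compl !ripE (ripC v (e v)) !se !ee; ring.
(* Pairing (v, w) with the projection of (f, 0) on the graph gives <v, f> = |f|^2, while the squared
   length of that projection is <b f, f> <= c |f|^2. *)
have := form_CS pair_form_form (v, w) (b f, ab f).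
have -> : pair_form (v, w) (b f, ab f) = nrm f ^+ 2.
  by rewrite -h2 (gE f _ avw).
have -> : pair_form (b f, ab f) (b f, ab f) = rip (b f) f by rewrite bE.
rewrite /pair_form /= !nrmE => h3.
have r0 : 0 <= r * nrm v by exact: le_trans (nrm_ge0 w) wr.
have h4 : nrm w ^+ 2 <= r ^+ 2 * nrm v ^+ 2.
  by rewrite -exprMn ler_sqr ?nnegrE ?nrm_ge0.
have F0 := sqr_ge0 (nrm f).
have h5 : nrm v ^+ 2 + nrm w ^+ 2 <= (1 + r ^+ 2) * nrm v ^+ 2 by lra.
have VW0 : 0 <= nrm v ^+ 2 + nrm w ^+ 2 by rewrite addr_ge0 ?sqr_ge0.
have h6 : nrm f ^+ 2 <= c * (nrm v ^+ 2 + nrm w ^+ 2).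
  apply: sqr_le_cancel; first by rewrite mulr_ge0// ltW.
  apply: le_trans h3 _; rewrite mulrAC mulrC.
  by rewrite ler_wpM2r.
by apply: le_trans h5; rewrite -ler_pdivlMl.
Qed.

(** * Comparison of projections *)

Lemma trace_projection_le tau p q (d : R) : fns_trace dot M tau ->
  projections dot M p -> projections dot M q -> 0 <= d < 1 ->
  (forall v, nrm (p (q v)) <= d * nrm v) ->
  (tau p <= tau (ortho_compl q))%E.
Proof.
move=> ttau Pp Pq /andP[d0 d1] pqd.
have Pq' := projection_ortho_compl Pq.
have /projectionsP[Mp pp sp] := Pp; have /projectionsP[Mq qq sq] := Pq.
have /projectionsP[] := Pq'; move: Pq'; set q' := ortho_compl q.
have q'E v : q' v = v - q v by [].
clearbody q' => Pq' Mq' qq' sq'.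
have bp := vna_blin Mp; have bq := vna_blin Mq.
(* A = 1 - p q p agrees with p (1 - q) p on the range of p but is invertible on all of H, so its
   root and inverse need no restriction to a subspace. *)
pose A v := v - p (q (p v)).
have MA : M A by apply: vna_sub vna_id _; apply: vna_comp => //; exact: vna_comp.
have bA := vna_blin MA.
have sA : sadj A by move=> u v; rewrite /A !ripE sp sq sp.
have AE v : rip (A v) v = nrm v ^+ 2 - nrm (q (p v)) ^+ 2.
  by rewrite -!nrmE sq qq /A (formBl rip_form) sp (ripC (p v)).
have qpd v : nrm (q (p v)) <= d * nrm v.
  apply: sqr_le_cancel; first by rewrite mulr_ge0 ?nrm_ge0.
  rewrite -nrmE sq qq sp.
  have := rip_le_nrm v (p (q (p v))); rewrite ler_norml => /andP[_ h].
  apply: le_trans h _; have := pqd (q (p v)); rewrite qq => h.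
  by have := nrm_ge0 v; nra.
have [v|h [bh sh h2 hh hT]] := sqrt_op bA sA.
  rewrite AE nrmE lerBlDr lerDl sqr_ge0 andbT subr_ge0.
  rewrite ler_sqr ?nnegrE ?nrm_ge0//; apply: le_trans (qpd v) _.
  by have := nrm_ge0 v; nra.
have hb := pos_bound bh.1 sh (ler0n R 2) h2.
(* Since A >= 1 - d^2 and h^2 <= 2 h, the root h is at least (1 - d^2) / 2. *)
have [||k [bk sk kh hk]] := @coercive_inverse h ((1 - d ^+ 2) / 2) bh sh.
- by nra.
- move=> v; have := hb v; rewrite -[rip (h v) (h v)]sh hh AE nrmE.
  have : nrm (q (p v)) ^+ 2 <= d ^+ 2 * nrm v ^+ 2.
    by rewrite -exprMn ler_sqr ?nnegrE ?mulr_ge0 ?nrm_ge0.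
  by lra.
have Mk : M k.
  apply: vna_mem_sadj => // S [bS Sm] sS v; apply/esym.
  by apply: (com_inverse kh hk) => x; apply: hT => // y; exact: Sm.
have kp : com p k.
  apply: (com_inverse kh hk) => x; apply: hT => // y.
  by rewrite /A (linB bp.1) !pp.
pose V v := q' (k (p v)); pose V' v := p (k (q' v)).
have MV : M V by apply: vna_comp => //; exact: vna_comp.
have MV' : M V' by apply: vna_comp => //; exact: vna_comp.
have VV' u v : rip (V u) v = rip u (V' v) by rewrite /V sq' sk sp.
have V'V v : V' (V v) = p v.
  rewrite /V' /V qq' kp; have -> : p (q' (k (p v))) = h (h (k (p v))).
    by rewrite hh /A -kp pp q'E (linB bp.1) pp.
  by rewrite kh hk.
have nV v : nrm (V v) <= nrm v.
  rewrite -ler_sqr ?nnegrE ?nrm_ge0// -!nrmE VV' V'V -pp -sp !nrmE.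
  by rewrite ler_sqr ?nnegrE ?nrm_ge0// nrm_projection.
have nV' v : nrm (V' v) <= nrm v.
  apply: sqr_le_cancel; first exact: nrm_ge0.
  rewrite -nrmE -VV' ripC.
  have := rip_le_nrm v (V (V' v)); rewrite ler_norml => /andP[_ h'].
  by apply: le_trans h' _; rewrite ler_wpM2l ?nrm_ge0.
have V'q v : V' (q' v) = V' v by rewrite /V' qq'.
(* D is positive: <D v, v> = |q' v|^2 - |V' (q' v)|^2, and V' is a contraction. *)
pose D v := q' v - V (V' v).
have pVV : positive_part dot M (fun v => V (V' v)).
  apply: positive_partP; first exact: vna_comp.
    by move=> u v; rewrite VV' ripC -VV' ripC.
  by move=> v; rewrite VV' rip_ge0.
have pD : positive_part dot M D.
  apply: positive_partP; first by apply: vna_sub => //; exact: vna_comp.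
    by move=> u v; rewrite /D !ripE sq' VV' (ripC (V' u)) -VV' (ripC _ u).
  move=> v; rewrite /D (formBl rip_form) VV' -{1}qq' sq' -V'q !nrmE subr_ge0.
  by rewrite ler_sqr ?nnegrE ?nrm_ge0.
have -> : p = V' \o V by apply/funext => v; rewrite /= V'V.
rewrite (trace_comm ttau MV); last exact: rip_is_adjoint (vna_blin MV').1 VV'.
have -> : q' = (fun v => V (V' v) + D v).
  by apply/funext => v; rewrite /D addrC subrK.
by rewrite (trace_add ttau)// leeDl// (trace_ge0 ttau).
Qed.

End VonNeumann.

(** * Singular values *)

Lemma comp_bounded_unbounded_operator (a : set (H * H)) p : linear p ->
  unbounded_operator a -> unbounded_operator (comp_bounded a p).
Proof.
move=> lp [a0 aL aF]; split; rewrite /comp_bounded /=.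
- by rewrite (lin0 lp).
- by move=> k q r aq ar; rewrite lp; exact: aL aq ar.
- by move=> w; rewrite (lin0 lp); exact: aF.
Qed.

Lemma opgraph_unbounded_operator (b : H -> H) : linear b ->
  unbounded_operator (opgraph b).
Proof.
move=> lb; split; rewrite /opgraph /=.
- by rewrite (lin0 lb).
- by move=> k q r /= -> ->; rewrite lb.
- by move=> w; rewrite (lin0 lb).
Qed.

Lemma opnorm_le (a : set (H * H)) (s : R) : unbounded_operator a -> 0 <= s ->
  (forall v, exists2 w, a (v, w) & nrm w <= s * nrm v) ->
  (opnorm a <= s%:E)%E.
Proof.
move=> [_ aL aF] s0 aw; rewrite /opnorm; case: asboolP => [_|[]]; last first.
  by apply/seteqP; split=> // v _; have [w avw _] := aw v; exists (v, w).
apply: ge_ereal_sup => _ [[v w] [avw /= v1] <-]; rewrite lee_fin -/(nrm w).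
have [w' avw' ww'] := aw v.
have -> : w = w'.
  apply/eqP; rewrite -subr_eq0; apply/eqP/aF.
  have -> : (0, w - w') = (-1) *: (v, w') + (v, w).
    by congr pair; rewrite /= scaleN1r ?addNr // [RHS]addrC.
  exact: aL.
by apply: le_trans ww' _; rewrite ler_piMr// -lecR -normE.
Qed.

Lemma opnorm_bound (a : set (H * H)) (s : R) : unbounded_operator a ->
  (opnorm a <= s%:E)%E ->
  forall v, exists2 w, a (v, w) & nrm w <= s * nrm v.
Proof.
move=> [a0 aL aF]; rewrite /opnorm; case: asboolP => [aT as_ v|//].
have [[v' w] avw /= v'v] : opdom a v by rewrite aT.
rewrite {}v'v in avw; exists w => //.
(* The zero vector cannot be normalized; there w = 0 because the graph is functional. *)
have [v0|v0] := eqVneq (nrm v) 0.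
  move: avw; rewrite v0 (nrm0_eq0 v0) => /aF ->.
  by rewrite /nrm normr0 mulr0.
have vgt : 0 < nrm v by rewrite lt_neqAle eq_sym v0 nrm_ge0.
have akw := aL (nrm v)^-1%:C _ _ avw a0; rewrite addr0 in akw.
rewrite -ler_pdivrMr// mulrC -[_^-1]gtr0_norm ?invr_gt0// -nrmZ -lee_fin.
apply: le_trans as_; apply: ereal_sup_ubound.
exists ((nrm v)^-1%:C *: (v, w)) => //; split=> //=.
by rewrite normE nrmZ gtr0_norm ?invr_gt0// mulVf.
Qed.

(** * Singular values of projections and the weight of a projection *)

Section Weights.
Context (M : set (H -> H)) (vM : von_neumann_algebra dot M).
Context (tau : (H -> H) -> \bar R) (ttau : fns_trace dot M tau).

Lemma projection_id : projections dot M id.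
Proof. by apply/(projectionsP vM); split=> //; exact: (vna_id vM). Qed.

Lemma mu_le_opnorm a e r : projections dot M e ->
  (tau (ortho_compl e) <= r%:E)%E ->
  (mu dot M tau a r <= opnorm (comp_bounded a e))%E.
Proof. by move=> Pe er; apply: ereal_inf_lbound; exists e. Qed.

(** A competitor q with |p q| < 1 would force tau(p) <= tau(1 - q) <= r by [trace_projection_le]. *)
Lemma mu_projection_ge1 p r : projections dot M p -> (r%:E < tau p)%E ->
  (1 <= mu dot M tau (opgraph p) r)%E.
Proof.
move=> Pp rp; apply: le_ereal_inf_tmp => _ [q [Pq qr] <-].
rewrite leNgt; apply/negP => q1.
have lp : linear p by have /(projectionsP vM)[/(vna_blin vM)[]] := Pp.
have lq : linear q by have /(projectionsP vM)[/(vna_blin vM)[]] := Pq.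
have := opnorm_ge0 (comp_bounded (opgraph p) q).
case E : (opnorm _) q1 => [d| |]//; rewrite lte_fin lee_fin => d1 d0.
suff h : (tau p <= tau (ortho_compl q))%E.
  by have := lt_le_trans rp (le_trans h qr); rewrite ltxx.
apply: (trace_projection_le vM (d := d)) => //; first by rewrite d0.
move=> v; have [||w] := @opnorm_bound (comp_bounded (opgraph p) q) d _ _ v.
- exact/comp_bounded_unbounded_operator/opgraph_unbounded_operator.
- by rewrite E.
- by rewrite /comp_bounded /opgraph /= => ->.
Qed.

Lemma trace0 : tau (fun=> 0) = 0%E.
Proof.
have P1 : positive_part dot M id.
  by apply: (positive_partP vM (vna_id vM)) => // v; exact: rip_ge0.
(* The convention 0 * +oo = 0 covers the case of an infinite trace of the identity. *)
have := trace_scale ttau (lexx 0) P1; rewrite mul0e => <-.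
by congr tau; apply/funext => v; rewrite scale0r.
Qed.

Lemma mu_projection_le1 p r : projections dot M p -> 0 <= r ->
  (mu dot M tau (opgraph p) r <= 1)%E.
Proof.
move=> Pp r0; have /(projectionsP vM)[/(vna_blin vM)[lp _] _ _] := Pp.
apply: le_trans (mu_le_opnorm _ projection_id _) _.
  have -> : ortho_compl id = (fun=> 0) :> (H -> H).
    by apply/funext => v; rewrite /ortho_compl subrr.
  by rewrite trace0 lee_fin.
apply: (opnorm_le (s := 1)) => //.
  by apply: comp_bounded_unbounded_operator => //; exact: opgraph_unbounded_operator.
by move=> v; exists (p v) => //; rewrite mul1r (nrm_projection vM).
Qed.

(** The competitor is 1 - p, for which p (1 - p) = 0. *)
Lemma mu_projection_le0 p r : projections dot M p -> (tau p <= r%:E)%E ->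
  (mu dot M tau (opgraph p) r <= 0)%E.
Proof.
move=> Pp pr; have /(projectionsP vM)[/(vna_blin vM)[lp _] pp _] := Pp.
have Pp' := projection_ortho_compl vM Pp.
have /(projectionsP vM)[/(vna_blin vM)[lp' _] _ _] := Pp'.
apply: le_trans (mu_le_opnorm _ Pp' _) _.
  rewrite (_ : ortho_compl _ = p)//.
  by apply/funext => v; rewrite /ortho_compl subKr.
apply: (opnorm_le (s := 0)) => //.
  by apply: comp_bounded_unbounded_operator => //; exact: opgraph_unbounded_operator.
move=> v; exists 0; rewrite ?mul0r /nrm ?normr0//.
by rewrite /comp_bounded /opgraph /= /ortho_compl (linB lp) pp subrr.
Qed.

(** This lemma and the next stand in for tau_x(p) = Phi(tau(p)). As mu(p) is the indicator function
    of r < tau(p), an inclusion between S and [0, tau(p)) becomes an inequality of integrals. *)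
Lemma mu_measure_le_tau_rel x p (S : set R) : measurable S ->
  projections dot M p -> (forall r, S r -> 0 <= r -> (r%:E < tau p)%E) ->
  (mu_measure dot M tau x S <= tau_rel dot M tau x (opgraph p))%E.
Proof.
move=> mS Pp Sp; rewrite /mu_measure /tau_rel setIC integral_mkcondr.
apply: ge0_le_integral => //.
- by move=> r _; rewrite patchE; case: ifPn => // _; exact: singular_value_ge0.
- apply/(measurable_restrict _ _ _).1 => //.
  by apply: measurable_singular_value; exact: measurableI.
- by apply: emeasurable_funM; exact: measurable_singular_value.
move=> r /=; rewrite in_itv /= andbT => r0; rewrite patchE.
case: ifPn => [/set_mem Sr|_]; last by apply: mule_ge0; exact: singular_value_ge0.
rewrite -[leLHS]mul1e; apply: lee_wpmul2r; first exact: singular_value_ge0.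
by apply: mu_projection_ge1 => //; exact: Sp.
Qed.

Lemma tau_rel_le_mu_measure x p (S : set R) : measurable S ->
  projections dot M p -> (forall r, 0 <= r -> (r%:E < tau p)%E -> S r) ->
  (tau_rel dot M tau x (opgraph p) <= mu_measure dot M tau x S)%E.
Proof.
move=> mS Pp Sp; rewrite /mu_measure /tau_rel setIC integral_mkcondr.
apply: ge0_le_integral => //.
- by move=> r _; apply: mule_ge0; exact: singular_value_ge0.
- by apply: emeasurable_funM; exact: measurable_singular_value.
- apply/(measurable_restrict _ _ _).1 => //.
  by apply: measurable_singular_value; exact: measurableI.
move=> r /=; rewrite in_itv /= andbT => r0; rewrite patchE.
case: ifPn => [_|Sr].
  rewrite -[leRHS]mul1e; apply: lee_wpmul2r; first exact: singular_value_ge0.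
  exact: mu_projection_le1.
have [pr|rp] := leP (tau p) r%:E; last by rewrite mem_set// in Sr; exact: Sp.
rewrite (_ : mu dot M tau (opgraph p) r = 0%E) ?mul0e//.
by apply/eqP; rewrite eq_le mu_projection_le0//=; exact: singular_value_ge0.
Qed.

Lemma measurable_mu_gt a (s : R) :
  measurable [set r : R | 0 <= r /\ (s%:E < `|mu dot M tau a r|)%E].
Proof.
have -> : [set r : R | 0 <= r /\ (s%:E < `|mu dot M tau a r|)%E] =
    `[0, +oo[ `&` mu dot M tau a @^-1` `]s%:E, +oo[.
  apply/seteqP; split=> r /=; rewrite !in_itv /= !andbT gee0_abs//;
    exact: singular_value_ge0.
have mf : measurable_fun (`[0, +oo[ : set R) (mu dot M tau a).
  exact: measurable_singular_value.
by apply: mf => //; exact: emeasurable_itv.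
Qed.

(** For s1 strictly between s and s', some q has |a q| < s1 and tau(1 - q) <= r. The cut inequality
    then bounds |(1 - e) q|^2 by (1 + s1^2) / (1 + s'^2) < 1, so 1 - e and q can be compared. *)
Lemma tau_le_of_mu_le a e (s s' r : R) : unbounded_operator a ->
  projections dot M e -> 0 <= s < s' ->
  (forall q r, a q -> nrm q.2 <= r * nrm q.1 ->
    (1 + s' ^+ 2) * nrm (ortho_compl e q.1) ^+ 2 <= (1 + r ^+ 2) * nrm q.1 ^+ 2) ->
  (mu dot M tau a r <= s%:E)%E -> (tau (ortho_compl e) <= r%:E)%E.
Proof.
move=> ua Pe /andP[s0 ss'] cut mus; pose s1 := (s + s') / 2.
have [ss1 s1s'] : s < s1 /\ s1 < s' by rewrite /s1; split; lra.
have /ereal_inf_lt[_ [q [Pq qr] <-] qs] : (mu dot M tau a r < s1%:E)%E.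
  by apply: le_lt_trans mus _; rewrite lte_fin.
apply: le_trans qr.
have lq : linear q by have /(projectionsP vM)[/(vna_blin vM)[]] := Pq.
have uq := comp_bounded_unbounded_operator lq ua.
have /(projectionsP vM)[_ qq _] := Pq.
have D0 : 0 < 1 + s' ^+ 2 by have := sqr_ge0 s'; lra.
pose d := (1 + s1 ^+ 2) / (1 + s' ^+ 2).
have d0 : 0 <= d by rewrite divr_ge0 ?(ltW D0)// addr_ge0// sqr_ge0.
have d1 : d < 1 by rewrite ltr_pdivrMr// mul1r ltrD2l; nra.
apply: (trace_projection_le vM (d := Num.sqrt d)) => //.
- exact: projection_ortho_compl.
- by rewrite sqrtr_ge0 -sqrtr1 ltr_sqrt.
move=> v; have [w aw wv] := opnorm_bound uq (ltW qs) (q v).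
rewrite /comp_bounded /= qq in aw.
have := cut (q v, w) s1 aw wv => /= h.
rewrite -ler_sqr ?nnegrE ?mulr_ge0 ?sqrtr_ge0 ?nrm_ge0// exprMn sqr_sqrtr//.
have h2 : nrm (q v) ^+ 2 <= nrm v ^+ 2.
  by rewrite ler_sqr ?nnegrE ?nrm_ge0// (nrm_projection vM).
rewrite /d mulrAC ler_pdivlMr// mulrC; apply: le_trans h _.
by rewrite ler_wpM2l// addr_ge0// sqr_ge0.
Qed.

End Weights.

End Hilbert.

(** * Equality of the rearrangement and the relative singular values *)

Theorem theorem3p7 (R : realType) (H : completeNormedModType R[i])
    (dot : {dot H for Num.conj}) (M : set (H -> H)) (tau : (H -> H) -> \bar R)
    (x a : set (H * H)) :
  inner_product_induces_norm dot ->
  von_neumann_algebra dot M ->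
  fns_trace dot M tau ->
  L1_plus_M dot M tau x ->
  x <> opgraph (fun=> 0) ->
  tau_measurable dot M tau a ->
  forall t : R, 0 <= t ->
    decreasing_rearrangement (mu_measure dot M tau x) (mu dot M tau a) t
    = mu_rel dot M tau a x t.
Proof.
move=> dotN vM ttau _ _ [ua ca _ aM _] t t0.
apply/eqP; rewrite eq_le; apply/andP; split.
(* Each e admissible for mu_t(a, x) makes s = |a e| admissible for the rearrangement: mu_r(a) > s
   forces r < tau(1 - e). An infinite norm leaves nothing to prove. *)
- apply: le_ereal_inf_tmp => _ [e [Pe et] <-].
  have Pe' := projection_ortho_compl dotN vM Pe.
  have := opnorm_ge0 (comp_bounded a e).
  case E : (opnorm _) => [s| |]//; last by move=> _; exact: leey.
  rewrite lee_fin => s0; apply: ereal_inf_lbound; exists s => //; split=> //.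
  apply: le_trans et; apply: mu_measure_le_tau_rel => //.
    exact: measurable_mu_gt.
  move=> r [r0]; rewrite gee0_abs; last exact: singular_value_ge0.
  move=> sr _; rewrite ltNge; apply/negP => er; move: sr; apply/negP.
  by rewrite -leNgt -E; exact: mu_le_opnorm.
apply: le_ereal_inf_tmp => _ [s [s0 st] <-].
(* The cut is made at s + d because [tau_le_of_mu_le] needs a level strictly above s. *)
apply/lee_addgt0Pr => d d0; rewrite -EFinD.
have sd : s < s + d by rewrite ltrDl.
have sd0 : 0 < s + d by exact: le_lt_trans sd.
have [e [Pe ae cut]] := operator_cut dotN vM ua ca aM sd0.
have Pe' := projection_ortho_compl dotN vM Pe.
have /(projectionsP dotN vM)[/(vna_blin dotN vM)[elin _] _ _] := Pe.
apply: (@le_trans _ _ (opnorm (comp_bounded a e))); last first.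
  apply: (opnorm_le _ (ltW sd0) ae); exact: comp_bounded_unbounded_operator.
apply: ereal_inf_lbound; exists e => //; split=> //=.
apply: le_trans st; apply: tau_rel_le_mu_measure => //.
  exact: measurable_mu_gt.
(* Contrapositive: mu_r(a) <= s would give tau(1 - e) <= r. *)
move=> r r0 er; split=> //; rewrite gee0_abs; last exact: singular_value_ge0.
rewrite ltNge; apply/negP => mus; move: er; apply/negP; rewrite -leNgt.
by apply: (tau_le_of_mu_le dotN vM ttau ua Pe _ cut mus); rewrite s0.
Qed.
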